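(* Let $p\ge 1$ be a real number and let $n\ge 0$ be an integer. Let $H$ be a finitely generated amenable group such that $j_{p,H}(x)\simeq j_{1,H}(x)$. Then the following holds for the $\ell^p$-isoperimetric profile of $\mathsf{Shuffler}^{\circ n}(H)$. (1) If $H$ has polynomial growth of degree $d\ge 1$, then $$j_{p,\mathsf{Shuffler}^{\circ n}(H)}(x)\simeq\left(\frac{\ln^{\circ n}(x)}{\ln^{\circ(n+1)}(x)}\right)^{\frac1d}.$$ (2) If the $\ell^p$-isoperimetric profile $j_{p,H}$ of $H$ satisfies Assumption $(\star)$ and $j_{p,H}\left(\frac{x}{\ln(x)}\right)\simeq j_{p,H}(x)$, then $$j_{p,\mathsf{Shuffler}^{\circ n}(H)}(x)\simeq j_{p,H}(\ln^{\circ n}(x)).$$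
   Context: Isoperimetric profile: for a finitely generated group $G$ with finite generating set $S_G$ and a real $p\ge 1$, $j_{p,G}(x)=\sup \|f\|_p/\|\nabla f\|_p$, the supremum being over (nonzero) functions $f\colon G\to\mathbb{R}_+$ with $|\mathrm{supp}\, f|\le x$, where $\mathrm{supp}\, f=\{g\in G: f(g)\neq 0\}$ and $\|\nabla f\|_p^p=\sum_{g\in G,\,s\in S_G}|f(g)-f(gs)|^p$. Up to the relation $\simeq$ below it does not depend on $S_G$. Asymptotic comparison: for non-decreasing functions, $f\preccurlyeq g$ means that there is $C>0$ such that $f(x)=O(g(Cx))$ as $x\to+\infty$; $f\simeq g$ means $f\preccurlyeq g$ and $g\preccurlyeq f$. Expressions are considered for $x$ large enough. $\ln^{\circ n}$ is the $n$-fold iterate of $\ln$ (with $\ln^{\circ 0}(x)=x$). Assumption $(\star)$: a non-decreasing function $h$ satisfies Assumption $(\star)$ if for every $C>0$, $h(Cx)=O(h(x))$ as $x\to+\infty$. Lampshuffler: $\mathsf{Shuffler}(H)=\mathsf{FSym}(H)\rtimes H$, where $\mathsf{FSym}(H)$ is the group of finitely supported bijections $H\to H$ and $H$ acts by $(h\cdot\sigma)(x)=h\sigma(h^{-1}x)$. Iterates: $\mathsf{Shuffler}^{\circ 0}(H)=H$ and $\mathsf{Shuffler}^{\circ n}(H)=\mathsf{Shuffler}(\mathsf{Shuffler}^{\circ(n-1)}(H))$ for $n\ge 1$.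
   Formalization: Part (1) is stated for n ≥ 1 only: for n = 0 the claimed profile (x/ln x)^{1/d} is false, since a group of polynomial growth of degree d has profile at least of order x^{1/d} (e.g. H = ℤ, p = 1, d = 1). Part (2) keeps n ≥ 0. *)

(* Defs.v *)
From HB Require Import structures.
From mathcomp Require Import all_boot all_order all_algebra finmap.
From mathcomp Require Import all_classical all_reals all_analysis.

Set Implicit Arguments.
Unset Strict Implicit.
Unset Printing Implicit Defensive.

Import Order.TTheory GRing.Theory Num.Theory.
Import numFieldNormedType.Exports.

Local Open Scope classical_set_scope.
Local Open Scope ring_scope.

Section FSym.
Variable H : groupType.

Definition is_finsym (s : H -> H) : bool :=
  `[< bijective s /\ finite_set [set x | s x <> x] >].

Record finsym := FinSym { finsym_fun :> H -> H; finsym_funP : is_finsym finsym_fun }.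

HB.instance Definition _ := [isSub for finsym_fun].
HB.instance Definition _ := [Choice of finsym by <:].

Lemma finsym_ext (s t : finsym) : s =1 t -> s = t.
Proof. by move=> st; apply/val_inj/funext. Qed.

Lemma is_finsym_id : is_finsym id.
Proof.
apply/asboolP; split; first by exists id.
by rewrite (_ : [set x | _] = set0)// -subset0 => x /=.
Qed.

Lemma is_finsym_comp (s t : H -> H) : is_finsym s -> is_finsym t -> is_finsym (s \o t).
Proof.
move=> /asboolP[bs fs] /asboolP[bt ft]; apply/asboolP; split; first exact: bij_comp.
have : finite_set ([set x | s x <> x] `|` [set x | t x <> x]) by rewrite finite_setU.
apply: sub_finite_set => x /= st; case: (pselect (t x = x)) => [tx|]; last by right.
by left; rewrite tx in st.
Qed.

Lemma finsym_inv_ex (s : finsym) :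
  {t : H -> H | [/\ cancel s t, cancel t s & is_finsym t]}.
Proof.
apply: cid; case: s => s /= /asboolP[[t st ts] fs]; exists t; split=> //.
apply/asboolP; split; first by exists s.
by apply: sub_finite_set fs => x /= tx sx; apply: tx; rewrite -{1}sx.
Qed.

Definition finsym_one : finsym := FinSym is_finsym_id.
Definition finsym_mul (s t : finsym) : finsym :=
  FinSym (is_finsym_comp (finsym_funP s) (finsym_funP t)).
Definition finsym_inv (s : finsym) : finsym :=
  let: exist t (And3 _ _ ft) := finsym_inv_ex s in FinSym ft.

Lemma finsym_mulA : associative finsym_mul. Proof. by move=> s t u; apply: finsym_ext => x. Qed.
Lemma finsym_mul1 : left_id finsym_one finsym_mul. Proof. by move=> s; apply: finsym_ext => x. Qed.
Lemma finsym_1mul : right_id finsym_one finsym_mul. Proof. by move=> s; apply: finsym_ext => x. Qed.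
Lemma finsym_mulV : left_inverse finsym_one finsym_inv finsym_mul.
Proof.
move=> s; apply: finsym_ext => x; rewrite /= /finsym_inv.
by case: finsym_inv_ex => t [? ? ?] /=.
Qed.
Lemma finsym_Vmul : right_inverse finsym_one finsym_inv finsym_mul.
Proof.
move=> s; apply: finsym_ext => x; rewrite /= /finsym_inv.
by case: finsym_inv_ex => t [? ? ?] /=.
Qed.

HB.instance Definition _ := isGroup.Build finsym
  finsym_mulA finsym_mul1 finsym_1mul finsym_mulV finsym_Vmul.

Lemma is_finsym_act (h : H) (s : H -> H) :
  is_finsym s -> is_finsym (fun x => h * s (h^-1 * x))%g.
Proof.
move=> /asboolP[[t st ts] fs]; apply/asboolP; split.
  by exists (fun x => h * t (h^-1 * x))%g => x; rewrite mulKg ?st ?ts mulVKg.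
apply: sub_finite_set (finite_image (fun x => h * x)%g fs) => x /= hx.
exists (h^-1 * x)%g; last by rewrite mulVKg.
by move=> e; apply: hx; rewrite e mulVKg.
Qed.

Definition finsym_act (h : H) (s : finsym) : finsym := FinSym (is_finsym_act h (finsym_funP s)).

Lemma finsym_act1 (s : finsym) : finsym_act 1%g s = s.
Proof. by apply: finsym_ext => x /=; rewrite invg1 !mul1g. Qed.

Lemma finsym_actM (h k : H) (s : finsym) :
  finsym_act (h * k)%g s = finsym_act h (finsym_act k s).
Proof. by apply: finsym_ext => x /=; rewrite invgM !mulgA. Qed.

Lemma finsym_act_mul (h : H) (s t : finsym) :
  finsym_act h (s * t)%g = (finsym_act h s * finsym_act h t)%g.
Proof. by apply: finsym_ext => x /=; rewrite mulKg. Qed.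

Lemma finsym_act_one (h : H) : finsym_act h 1%g = 1%g.
Proof. by apply: finsym_ext => x /=; rewrite mulVKg. Qed.

End FSym.

Section Shuffler.
Variable H : groupType.

(* Not an alias of the product type, which already carries the direct product
   group structure. *)
Record shuffler_sort := Shuffler { lamp : finsym H; cursor : H }.

Definition shuffler_pair (a : shuffler_sort) : finsym H * H := (lamp a, cursor a).
Definition pair_shuffler (a : finsym H * H) : shuffler_sort := Shuffler a.1 a.2.
Lemma shuffler_pairK : cancel shuffler_pair pair_shuffler. Proof. by case. Qed.

HB.instance Definition _ := Choice.copy shuffler_sort (can_type shuffler_pairK).

Definition shuffler_one := Shuffler 1%g 1%g.
Definition shuffler_mul (a b : shuffler_sort) :=
  Shuffler (lamp a * finsym_act (cursor a) (lamp b))%g (cursor a * cursor b)%g.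
Definition shuffler_inv (a : shuffler_sort) :=
  Shuffler (finsym_act (cursor a)^-1 (lamp a)^-1)%g (cursor a)^-1%g.

Lemma shuffler_mulA : associative shuffler_mul.
Proof.
move=> [s h] [t k] [u l]; rewrite /shuffler_mul /=.
by rewrite finsym_act_mul finsym_actM !mulgA.
Qed.
Lemma shuffler_mul1 : left_id shuffler_one shuffler_mul.
Proof. by move=> [s h]; rewrite /shuffler_mul /= finsym_act1 !mul1g. Qed.
Lemma shuffler_1mul : right_id shuffler_one shuffler_mul.
Proof. by move=> [s h]; rewrite /shuffler_mul /= finsym_act_one !mulg1. Qed.
Lemma shuffler_mulV : left_inverse shuffler_one shuffler_inv shuffler_mul.
Proof.
by move=> [s h]; rewrite /shuffler_mul /= -finsym_act_mul !mulVg finsym_act_one.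
Qed.
Lemma shuffler_Vmul : right_inverse shuffler_one shuffler_inv shuffler_mul.
Proof.
by move=> [s h]; rewrite /shuffler_mul /= -finsym_actM !mulgV finsym_act1 mulgV.
Qed.

HB.instance Definition _ := isGroup.Build shuffler_sort
  shuffler_mulA shuffler_mul1 shuffler_1mul shuffler_mulV shuffler_Vmul.

End Shuffler.

Definition shuffler (H : groupType) : groupType := shuffler_sort H.

Definition shuffler_iter (n : nat) (H : groupType) : groupType := iter n shuffler H.

Section GeometricGroupTheory.
Local Open Scope fset_scope.
Variable G : groupType.
Implicit Types S F : {fset G}.

(* word_ball S r = products of at most r elements of S and their inverses *)
Fixpoint word_ball S (r : nat) : {fset G} :=
  if r is r'.+1 then
    word_ball S r' `|` [fset (g * s)%g | g in word_ball S r', s in S]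
              `|` [fset (g * s^-1)%g | g in word_ball S r', s in S]
  else [fset 1%g].

Definition generates S : Prop := forall g : G, exists r : nat, g \in word_ball S r.

(* Foelner's condition, with epsilon = 1 / k *)
Definition amenable : Prop :=
  forall (K : {fset G}) (k : nat), exists2 F : {fset G}, F != fset0 &
    forall g, g \in K ->
      let Fg := [fset (x * g)%g | x in F] in
      (k * #|` (Fg `\` F) `|` (F `\` Fg)| <= #|` F|)%N.

Definition polynomial_growth S (d : nat) : Prop :=
  exists2 K : nat, (0 < K)%N & forall r : nat, (1 <= r)%N ->
    (r ^ d <= K * #|` word_ball S r|)%N /\ (#|` word_ball S r| <= K * r ^ d)%N.

End GeometricGroupTheory.

Section Profile.
Variables (R : realType) (G : groupType).
Implicit Types (p x : R) (S : {fset G}) (f : G -> R).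

Definition supp f : set G := [set g | f g != 0].

(* The sums range over all of G; they are used for finitely supported f, hence
   have finitely many nonzero terms. *)
Definition norm_lp p f : R := (\sum_(g \in [set: G]) `|f g| `^ p) `^ p^-1.

Definition norm_grad p S f : R :=
  (\sum_(g \in [set: G]) \sum_(s <- S) `|f g - f (g * s)%g| `^ p) `^ p^-1.

(* The supremum is taken in \bar R, where r / 0 = +oo for r > 0; the gradient of
   an admissible f vanishes only if G is finite. *)
Definition profile p S x : \bar R :=
  ereal_sup [set ((norm_lp p f)%:E / (norm_grad p S f)%:E)%E | f in
    [set f : G -> R | [/\ forall g, 0 <= f g, exists g, f g != 0,
       finite_set (supp f) & #|` fset_set (supp f)|%:R <= x]]].

End Profile.

Section Asymptotics.
Variable R : realType.
Implicit Types f g : R -> \bar R.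

Definition bigO_infty f g : Prop :=
  exists2 K : R, 0 < K & \forall x \near +oo, (`|f x| <= K%:E * `|g x|)%E.

Definition asymp_le f g : Prop := exists2 C : R, 0 < C & bigO_infty f (fun x => g (C * x)).

Definition asymp_eq f g : Prop := asymp_le f g /\ asymp_le g f.

Definition assumption_star f : Prop := forall C : R, 0 < C -> bigO_infty (fun x => f (C * x)) f.

Definition iter_ln (n : nat) (x : R) : R := iter n (@ln R) x.

End Asymptotics.

(* Main.v *)
Require Import Defs.
From HB Require Import structures.
From mathcomp Require Import all_boot all_order all_algebra finmap.
From mathcomp Require Import all_classical all_reals all_analysis.
From mathcomp Require Import zify ring lra.

(** Lower bound: if [f] is supported in [A], then [(s, h) |-> f h], restricted to
the [s] supported in [A], has the same ratio [norm_lp / norm_grad] as [f] up to a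
constant and lives on at most [|A| ^ (|A| + 1)] points, because a lamp move at
[h] can leave [Sym A] only if some [h * y] with [y] in a fixed finite set leaves
[A], where [f] vanishes.

Upper bound: replacing [f] by [f ^ p] and passing to level sets reduces to finite
sets [F] of [Shuffler G] with small boundary. Most of the slices of [F] at
fixed permutation also have small boundary. If they all had more than
[8 * log |F|] elements, the set of permutations would contain too many edges
[s, s * (g, g * s0)], since a set [X] of permutations spans at most
[4 |X| log |X|] of those. So a slice of size [O(log |F|)] is as good as [F].

In polynomial growth one more factor [log] is needed at the innermost level.
If [|bd F| <= c |F| / r], the fiber of [F] over a well chosen [g] is almost
invariant under all transpositions of the ball [g B(r)]; a set of permutations
with this property has at least [q ^ q] elements, [q = |B(r)| / 8]. *)

Set Implicit Arguments.
Unset Strict Implicit.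
Unset Printing Implicit Defensive.

Import Order.TTheory GRing.Theory Num.Theory.
Import numFieldNormedType.Exports.

Local Open Scope ring_scope.

(** * Finite sets with small boundary *)

Section FsetSums.
Local Open Scope fset_scope.
Local Open Scope nat_scope.

(** The two bounds do not meet by themselves. A set of size [m] lifts to size about [m ^ m], with
    inverse [ln x / ln (ln x)], whereas slices only give [ln x]. Between outer levels the
    discrepancy disappears, because the next logarithm barely sees a factor [ln]; it remains at the
    innermost group [H]. In part (2) the hypothesis on [x / ln x] absorbs it. In part (1) it is a
    real gap: slicing exploits the swaps along one fixed generator, and the missing logarithm comes
    from using all transpositions of a ball of radius [r] at once. Each of them must cost [O(r)]
    moves, since a quadratic cost would spoil the exponent [1 / d]. Comparisons between a set and
    its slice, or a function and its lift, are cross-multiplied, with constants fixed in advance: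
    they compose along the iterates and never divide by a gradient that might vanish. *)

Lemma leq_sum_fset_inj (I J : choiceType) (A : {fset I}) (B : {fset J})
    (P : pred I) (h : I -> J) (f : J -> nat) :
  {in A &, injective h} -> (forall x, x \in A -> P x -> h x \in B) ->
  \sum_(x <- A | P x) f (h x) <= \sum_(y <- B) f y.
Proof.
move=> h_inj hB; have -> : \sum_(x <- A | P x) f (h x) =
          \sum_(y <- [fset h x | x in [fset x in A | P x]]) f y.
  rewrite big_imfset/=; last first.
    by move=> x y; rewrite !inE => /andP[xA _] /andP[yA _]; exact: h_inj.
  by rewrite -big_fset_condE.
set C := imfset _ _ _; rewrite [leqRHS](big_fsetID _ (mem C))/=.
apply: leq_trans (leq_addr _ _); rewrite leq_eqVlt; apply/orP; left; apply/eqP.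
apply: eq_fbigl => y; rewrite !inE andbC.
case: (boolP (y \in C)) => //= /imfsetP[x /=]; rewrite !inE => /andP[xA Px] ->.
by rewrite hB.
Qed.

Lemma card_fsetE_sum (I : choiceType) (A : {fset I}) (P : pred I) :
  #|` [fset x in A | P x]| = \sum_(x <- A) P x.
Proof. by rewrite card_fset_sum1 big_fset/= -big_mkcond sum1_count -sum1_count. Qed.

Lemma leq_sum_fset (I : choiceType) (A : {fset I}) (f g : I -> nat) :
  (forall x, x \in A -> f x <= g x) -> \sum_(x <- A) f x <= \sum_(x <- A) g x.
Proof. by move=> fg; rewrite big_seq [leqRHS]big_seq; apply: leq_sum. Qed.

Lemma sum_fset_const (I : choiceType) (A : {fset I}) (n : nat) :
  \sum_(x <- A) n = #|` A| * n.
Proof. by rewrite big_const_seq count_predT iter_addn_0 mulnC. Qed.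

End FsetSums.

Section Outflow.
Local Open Scope fset_scope.
Local Open Scope nat_scope.
Variable G : groupType.
Implicit Types (F U S : {fset G}) (u w : G).

(** Only exits are counted. By [outflowV] the entries are equally many, so this is half of the usual
    symmetric difference; it is a natural number, subadditive in [w]. *)
Definition outflow F w : nat := \sum_(x <- F) ((x * w)%g \notin F).
Definition boundary S F : nat := \sum_(s <- S) outflow F s.

Lemma outflow1 F : outflow F 1%g = 0.
Proof. by rewrite /outflow big1_fset// => x xF _; rewrite mulg1 xF. Qed.

Lemma outflowM F u w : outflow F (u * w)%g <= outflow F u + outflow F w.
Proof.
rewrite /outflow; pose Q x := (x * u)%g \in F.
apply: (@leq_trans (\sum_(x <- F) ((x * u)%g \notin F) +
                    \sum_(x <- F | Q x) ((x * u * w)%g \notin F))).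
  rewrite [X in _ + X]big_mkcond/= -big_split; apply: leq_sum_fset => x _ /=.
  by rewrite mulgA /Q; case: ((x * u)%g \in F) => //=; case: (_ \in F).
rewrite leq_add2l; apply: (leq_sum_fset_inj (h := fun x => (x * u)%g)
  (fun x => nat_of_bool ((x * w)%g \notin F))) => // x y _ _.
exact: mulIg.
Qed.

Lemma leq_outflowM F u w a b :
  outflow F u <= a -> outflow F w <= b -> outflow F (u * w)%g <= a + b.
Proof. by move=> ua wb; apply: leq_trans (outflowM _ _ _) (leq_add ua wb). Qed.

Lemma sum_in_translate F w :
  \sum_(x <- F) ((x * w)%g \in F) + outflow F w = #|` F|.
Proof.
rewrite /outflow -big_split/= card_fset_sum1; apply: eq_bigr => x _.
by case: (_ \in F).
Qed.

(** Translation by [w] maps the points that stay in [F] bijectively to those that stay under [w^-1],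
    so the leavers are equally many. *)
Lemma outflowV F w : outflow F w^-1%g = outflow F w.
Proof.
suff le u : \sum_(x <- F) ((x * u)%g \in F) <= \sum_(x <- F) ((x * u^-1)%g \in F).
  have := sum_in_translate F w; have := sum_in_translate F w^-1%g.
  by have := le w; have := le w^-1%g; rewrite invgK; lia.
rewrite [leqLHS](_ : _ = \sum_(x <- F | (x * u)%g \in F) ((x * u * u^-1)%g \in F)).
  by apply: (leq_sum_fset_inj (h := fun x => (x * u)%g)
    (fun x => nat_of_bool ((x * u^-1)%g \in F))) => // x y _ _; exact: mulIg.
rewrite [RHS]big_mkcond/=; apply: eq_fbigr => x xF _; rewrite mulgK xF.
by case: (_ \in F).
Qed.

Lemma outflow_boundary U F u : u \in U -> outflow F u <= boundary U F.
Proof. by move=> uU; rewrite /boundary (big_fsetD1 u uU)/= leq_addr. Qed.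

Lemma word_ball1 U r : 1%g \in word_ball U r.
Proof. by elim: r => [|r IH] /=; rewrite !inE// IH. Qed.

Lemma word_ballSE U r g : reflect
  (g \in word_ball U r \/ exists2 h, h \in word_ball U r &
     exists2 u, u \in U & g = (h * u)%g \/ g = (h * u^-1)%g)
  (g \in word_ball U r.+1).
Proof.
rewrite /= !inE -orbA; apply: (iffP or3P).
  case=> [gU|/imfset2P[h hU [u uU ->]]|/imfset2P[h hU [u uU ->]]]; first by left.
  - by right; exists h => //; exists u => //; left.
  - by right; exists h => //; exists u => //; right.
move=> [gU|[h hU [u uU [->|->]]]]; first by constructor.
- by constructor 2; apply/imfset2P; exists h => //; exists u.
- by constructor 3; apply/imfset2P; exists h => //; exists u.
Qed.

End Outflow.

(** * Transpositions and an edge-isoperimetric inequality for permutations *)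

Section Transposition.
Local Open Scope fset_scope.
Local Open Scope nat_scope.
Variable G : groupType.
Implicit Types (a b g h : G) (s t : finsym G) (X : {fset finsym G}).

Definition swap a b g := if g == a then b else if g == b then a else g.

Lemma swapK a b : involutive (swap a b).
Proof.
move=> g; rewrite /swap; have [->|ga] := eqVneq g a.
  by rewrite eqxx; case: eqVneq.
by have [->|gb] := eqVneq g b; rewrite ?eqxx// (negPf ga) (negPf gb).
Qed.

Lemma swap_finsym a b : is_finsym (swap a b).
Proof.
apply/asboolP; split; first by exists (swap a b); exact: swapK.
apply: (@sub_finite_set _ _ [set` [fset a; b]]) => // g /=; rewrite !inE /swap.
by case: eqVneq => //= _; case: eqVneq.
Qed.

Definition transp a b : finsym G := FinSym (swap_finsym a b).

Lemma transpE a b g : transp a b g = swap a b g. Proof. by []. Qed.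

Lemma finsym_mulE s t g : (s * t)%g g = s (t g). Proof. by []. Qed.

Lemma transpL a b : transp a b a = b. Proof. by rewrite transpE /swap eqxx. Qed.

Lemma transpR a b : transp a b b = a.
Proof. by rewrite transpE /swap eqxx; case: eqVneq. Qed.

Lemma transpD a b g : g != a -> g != b -> transp a b g = g.
Proof. by rewrite transpE /swap => /negPf-> /negPf->. Qed.

Lemma transpC a b : transp a b = transp b a.
Proof.
apply: finsym_ext => g; rewrite !transpE /swap.
by case: (eqVneq g a) => [->|//]; case: eqVneq.
Qed.

Lemma transpK a b s : (s * transp a b * transp a b)%g = s.
Proof. by apply: finsym_ext => g; rewrite !finsym_mulE !transpE swapK. Qed.

Lemma transpaa a : transp a a = 1%g.
Proof. by apply: finsym_ext => g; rewrite transpE /swap; case: eqVneq. Qed.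

Lemma act_transp h a b : finsym_act h (transp a b) = transp (h * a)%g (h * b)%g.
Proof.
apply: finsym_ext => g /=; rewrite /swap !(can2_eq (mulVKg h) (mulKg h)).
by case: eqVneq => // _; case: eqVneq => // _; rewrite mulVKg.
Qed.

Lemma finsym_inj s : injective s.
Proof. by case: s => s sP; case/asboolP: (sP) => /bij_inj. Qed.

End Transposition.

Section EdgeIsoperimetry.
Local Open Scope fset_scope.
Local Open Scope nat_scope.
Variables (G : groupType) (s0 : G).
Hypothesis s0_neq1 : s0 != 1%g.
Variable Q : {fset G}.
Implicit Types (X Y : {fset finsym G}).

Let adj (s : finsym G) (g : G) := (s * transp g (g * s0)%g)%g.

Definition edges X Y : nat := \sum_(s <- X) \sum_(g <- Q) (adj s g \in Y).

Lemma edgesC X Y : edges X Y = edges Y X.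
Proof.
suff le Z W : edges Z W <= edges W Z by apply/eqP; rewrite eqn_leq !le.
rewrite /edges exchange_big/= [leqRHS]exchange_big/=.
apply: leq_sum => g _.
rewrite [leqLHS](_ : _ = \sum_(s <- Z | adj s g \in W) (adj (adj s g) g \in Z)).
  apply: (leq_sum_fset_inj (h := adj^~ g) (fun s => nat_of_bool (adj s g \in Z))) => //.
  by move=> s t _ _; apply: mulIg.
rewrite [RHS]big_mkcond/=; apply: eq_fbigr => s sZ _.
by rewrite /adj transpK sZ; case: (_ \in W).
Qed.

(* Only [g = h] and [g * s0 = h] can move the value at [h]. *)
Lemma edges_cross X Y (h : G) :
  (forall s t, s \in X -> t \in Y -> s h != t h) -> edges X Y <= 2 * #|` X|.
Proof.
move=> dXY; rewrite mulnC -sum_fset_const; apply: leq_sum_fset => s sX.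
apply: (@leq_trans (\sum_(g <- Q) ((g == h) + (g == (h * s0^-1)%g)))).
  apply: leq_sum => g _; case: (boolP (adj s g \in Y)) => //= tY.
  have := dXY _ _ sX tY; rewrite /adj finsym_mulE.
  have [->//|gh] := eqVneq g h; have [->|gs] := eqVneq g (h * s0^-1)%g => //.
  rewrite transpD ?eqxx// eq_sym//.
  by rewrite (can2_eq (mulgK s0) (mulgVK s0)).
have le1 k : \sum_(g <- Q) (g == k) <= 1.
  rewrite -big_mkcond/= sum1_count count_uniq_mem ?fset_uniq//; exact: leq_b1.
by rewrite big_split/=; apply: (leq_add (le1 _) (le1 _)).
Qed.

Lemma edges_split X Y (P : pred (finsym G)) :
  edges X Y = edges [fset s in X | P s] Y + edges [fset s in X | ~~ P s] Y.
Proof. exact: big_fsetID. Qed.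

(** In logarithmic form, at most [4 |X| log2 |X|] edges, as in the edge-isoperimetric inequality of
    the cube. The value at an endpoint [g] of some edge splits [X] into two nonempty parts. Each
    permutation sends at most two edges across, so a smaller part of size [a] costs at most [4 * a]
    edges, counted in both directions; convexity of [x * log x] pays for them. *)
Lemma edge_isoperimetry X : 2 ^ edges X X <= #|` X| ^ (4 * #|` X|).
Proof.
have [n] := ubnP #|` X|; elim: n X => // n IH X leXn.
have [->|] := posnP (edges X X).
  by rewrite expn0; case: #|` X| => // m; rewrite expn_gt0.
rewrite lt0n => /eqP e_neq0.
have [s sX [g [gQ tX]]] : exists2 s, s \in X & exists g, g \in Q /\ adj s g \in X.
  apply: contrapT => no; apply: e_neq0; apply: big1_fset => s sX _.
  apply: big1_fset => g gQ _; case: (boolP (_ \in X)) => // tX.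
  by case: no; exists s => //; exists g.
pose P (t : finsym G) := t g == s g.
set X0 := [fset t in X | P t]; set X1 := [fset t in X | ~~ P t].
have sX0 : s \in X0 by rewrite !inE /= sX /P eqxx.
have tX1 : adj s g \in X1.
  rewrite !inE /= tX /P /adj finsym_mulE transpL (inj_eq (@finsym_inj _ s)).
  by rewrite -{2}(mulg1 g) (inj_eq (mulgI g)).
have cX : #|` X0| + #|` X1| = #|` X| by rewrite !card_fset_sum1 -big_fsetID.
have a_gt0 : 0 < #|` X0| by rewrite cardfs_gt0; apply/fset0Pn; exists s.
have b_gt0 : 0 < #|` X1| by rewrite cardfs_gt0; apply/fset0Pn; exists (adj s g).
have disj u v : u \in X0 -> v \in X1 -> u g != v g.
  by rewrite !inE /P => /andP[_ /eqP ->] /andP[_]; rewrite eq_sym.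
have c0 := edges_cross disj.
have c1 : edges X1 X0 <= 2 * #|` X1|.
  by apply: (edges_cross (h := g)) => u v uX vX; rewrite eq_sym; exact: disj.
have := IH X0; have := IH X1.
have -> : edges X X = edges X0 X0 + edges X1 X1 + 2 * edges X0 X1.
  rewrite (edges_split X X P) -/X0 -/X1 (edgesC X0 X) (edgesC X1 X).
  rewrite (edges_split X X0 P) (edges_split X X1 P) -/X0 -/X1 (edgesC X1 X0).
  by lia.
rewrite (edgesC X1 X0) in c1; rewrite -cX in leXn *.
move: (edges X0 X0) (edges X1 X1) (edges X0 X1) c0 c1 => e0 e1 e.
move: #|` X0| #|` X1| a_gt0 b_gt0 leXn => a b a_gt0 b_gt0 leXn ea eb.
move=> /(_ ltac:(lia)) IHb /(_ ltac:(lia)) IHa.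
wlog ab : a b e0 e1 a_gt0 b_gt0 leXn ea eb IHa IHb / a <= b.
  move=> W; have [ab|/ltnW ba] := leqP a b; first exact: (W a b e0 e1).
  rewrite (addnC a) (addnC e0); apply: (W b a e1 e0) => //; lia.
(* The [2] in [2 * a] yields the factor [2 ^ (4 * a)] for the crossing edges, and
   [2 * a <= a + b]. *)
apply: (@leq_trans ((2 * a) ^ (4 * a) * b ^ (4 * b))).
  have -> : (2 * a) ^ (4 * a) * b ^ (4 * b) = a ^ (4 * a) * b ^ (4 * b) * 2 ^ (4 * a).
    by rewrite expnMn -mulnA mulnC.
  rewrite 2!expnD; apply: leq_mul; first by apply: (leq_mul IHa IHb).
  by apply: (@leq_pexp2l 2 _ _ isT); lia.
rewrite mulnDr (expnD _ (4 * a)); apply: leq_mul.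
  by rewrite leq_exp2r ?muln_gt0//; lia.
by rewrite leq_exp2r ?muln_gt0//; lia.
Qed.

End EdgeIsoperimetry.

(** * Slices of subsets of the lampshuffler *)

Section Slices.
Local Open Scope fset_scope.
Local Open Scope nat_scope.
Variable G : groupType.
Implicit Types (F U : {fset shuffler G}) (S : {fset G}) (g h s : G) (t : finsym G)
  (x : shuffler G).

Definition cursor_move s : shuffler G := Shuffler 1%g s.
Definition lamp_move t : shuffler G := Shuffler t 1%g.

Lemma mul_shufflerE x y : (x * y)%g = shuffler_mul x y. Proof. by []. Qed.

Lemma mul_cursor_move x s : (x * cursor_move s)%g = Shuffler (lamp x) (cursor x * s)%g.
Proof. by rewrite mul_shufflerE /shuffler_mul /= finsym_act_one mulg1. Qed.

Lemma mul_lamp_move x t :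
  (x * lamp_move t)%g = Shuffler (lamp x * finsym_act (cursor x) t)%g (cursor x).
Proof. by rewrite mul_shufflerE /shuffler_mul /= mulg1. Qed.

Lemma shuffler_eta x : Shuffler (lamp x) (cursor x) = x. Proof. by case: x. Qed.

Definition lamps F := [fset lamp x | x in F].
Definition slice F t := [fset cursor x | x in [fset x in F | lamp x == t]].

Lemma in_slice F t h : (h \in slice F t) = (Shuffler t h \in F).
Proof.
apply/imfsetP/idP => [[x /= ]|tF].
  by rewrite !inE => /andP[xF /eqP <-] ->; rewrite shuffler_eta.
by exists (Shuffler t h) => //=; rewrite !inE/= tF eqxx.
Qed.

Lemma sum_slice F (f : finsym G -> G -> nat) :
  \sum_(x <- F) f (lamp x) (cursor x) = \sum_(t <- lamps F) \sum_(h <- slice F t) f t h.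
Proof.
rewrite (partition_big_imfset _ (@lamp G)); apply: eq_fbigr => t _ _.
rewrite /slice big_imfset/=; last first.
  move=> x y; rewrite !inE/= => /andP[_ /eqP lx] /andP[_ /eqP ly] cxy.
  by rewrite -(shuffler_eta x) -(shuffler_eta y) lx ly cxy.
by rewrite big_fset_condE; apply: eq_fbigr => x; rewrite !inE => /andP[_ /eqP ->].
Qed.

Lemma outflow_cursor_move F s :
  \sum_(t <- lamps F) outflow (slice F t) s = outflow F (cursor_move s).
Proof.
rewrite /outflow; transitivity (\sum_(x <- F) (Shuffler (lamp x) (cursor x * s)%g \notin F)).
  rewrite (sum_slice F (fun t h => Shuffler t (h * s)%g \notin F)).
  by apply: eq_bigr => t _; apply: eq_bigr => h _; rewrite in_slice.
by apply: eq_bigr => x _; rewrite mul_cursor_move.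
Qed.

Lemma boundary_slices F S U : (forall s, s \in S -> cursor_move s \in U) ->
  \sum_(t <- lamps F) boundary S (slice F t) <= boundary U F.
Proof.
move=> SU; rewrite /boundary exchange_big/=.
under eq_bigr do rewrite outflow_cursor_move.
by apply: (leq_sum_fset_inj (h := cursor_move) (P := predT)) => [s s' _ _ []|s /SU].
Qed.

Lemma boundary_fset1 S g : boundary S [fset g] <= #|` S|.
Proof.
rewrite /boundary card_fset_sum1; apply: leq_sum_fset => s _.
by rewrite /outflow big_seq_fset1; exact: leq_b1.
Qed.

Lemma shuffler_slice_profile S : exists (U : {fset shuffler G}) (C : nat),
  forall F, F != fset0 -> exists F' : {fset G}, [/\ F' != fset0,
    2 ^ #|` F'| <= 2 * #|` F| ^ 8 &
    boundary S F' * #|` F| <= C * boundary U F * #|` F'|].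
Proof.
have [[s0 [s0S s0_neq1]]|noS] := pselect (exists s, s \in S /\ s != 1%g); last first.
  exists fset0, 0 => F F0; exists [fset 1%g]; split=> //.
  - by apply/fset0Pn; exists 1%g; rewrite inE.
  - by rewrite cardfs1 expn1 -[leqLHS]muln1 leq_mul// expn_gt0 cardfs_gt0 F0.
  - rewrite (_ : boundary _ _ = 0)//; apply: big1_fset => s sS _.
    have [->|s1] := eqVneq s 1%g; first exact: outflow1.
    by case: noS; exists s.
(* At a point with cursor [g], this move multiplies the lamp by [transp g (g * s0)]: it walks along
   the edges counted by [edges s0]. *)
pose tau := lamp_move (transp 1%g s0).
pose U := tau |` [fset cursor_move s | s in S].
have SU s : s \in S -> cursor_move s \in U.
  by move=> sS; rewrite /U inE; apply/orP; right; apply/imfsetP; exists s.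
exists U, (20 * #|` S| + 10) => F F0.
have n_gt0 : 0 < #|` F| by rewrite cardfs_gt0.
set b := boundary U F; set n := #|` F| in n_gt0 *.
have sumb := boundary_slices F SU; rewrite -/b in sumb.
(* A set with a large boundary is matched by a singleton, whose boundary is at most [#|S|]. *)
have [small|big] := leqP n (20 * b).
  exists [fset 1%g]; split.
  - by apply/fset0Pn; exists 1%g; rewrite inE.
  - by rewrite cardfs1 expn1 -[leqLHS]muln1 leq_mul// expn_gt0 n_gt0.
  - apply: leq_trans (leq_mul (boundary_fset1 S 1%g) small) _.
    by rewrite cardfs1 muln1 mulnA mulnDl (mulnC 20) leq_addr.
apply: contrapT => no.
pose X := [fset t in lamps F | boundary S (slice F t) * n <= 10 * b * #|` slice F t|].
have XP t : t \in X -> 2 * n ^ 8 < 2 ^ #|` slice F t|.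
  rewrite !inE => /andP[/imfsetP[x /= xF ->] tb]; rewrite ltnNge; apply/negP => le.
  apply: no; exists (slice F (lamp x)); split=> //; last first.
    by apply: leq_trans tb _; rewrite -!mulnA leq_mul// leq_addl.
  by apply/fset0Pn; exists (cursor x); rewrite in_slice shuffler_eta.
(* Markov's inequality: outside [X] the boundary of a slice exceeds [10 * b / n] times its size,
   while all slice boundaries add up to at most [b]. If [b = 0], every slice is good. *)
have [beta [betaE betan]] : exists beta, beta = \sum_(x <- F) (lamp x \notin X) /\
    10 * beta <= n.
  eexists; split; first by [].
  rewrite (sum_slice F (fun t _ => t \notin X)).
  under eq_bigr do rewrite sum_fset_const.
  have [b0|b_gt0] := posnP b.
    rewrite big1_fset// => t tL _.
    rewrite (_ : t \in X) ?muln0// !inE tL/=.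
    have le : boundary S (slice F t) <= \sum_(t <- lamps F) boundary S (slice F t).
      by rewrite (big_fsetD1 t)//= leq_addr.
    by rewrite (_ : boundary _ _ = 0)//; lia.
  rewrite -(leq_pmul2l b_gt0); apply: (@leq_trans (n * b)); last by lia.
  apply: leq_trans (leq_mul (leqnn n) sumb); rewrite mulnA !big_distrr/=.
  apply: leq_sum_fset => t tL; have [//|] := boolP (t \in X); first by lia.
  by rewrite !inE tL/= -ltnNge; lia.
pose Q := [fset cursor x | x in F].
pose E := edges s0 Q X X.
pose adj t g := (t * transp g (g * s0))%g.
have tauE x : (x * tau)%g = Shuffler (adj (lamp x) (cursor x)) (cursor x).
  by rewrite mul_lamp_move act_transp mulg1.
(* For each [x] in [F], either the edge from [lamp x] at its cursor stays in [X], or [x * tau]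
   leaves [F], or one of the two endpoints has a bad lamp. Injectivity of translation bounds the bad
   second endpoints by [beta] as well. Since [b < n / 20] and [beta <= n / 10], this leaves
   [n <= 2 * E]. *)
have nE : n <= E + b + 2 * beta.
  apply: (@leq_trans (\sum_(x <- F) (((lamp x \in X) && (adj (lamp x) (cursor x) \in X)) +
     ((x * tau)%g \notin F) + (lamp x \notin X) +
     ((x * tau)%g \in F) * (lamp (x * tau)%g \notin X)))).
    rewrite /n card_fset_sum1; apply: leq_sum_fset => x xF; rewrite tauE/=.
    by do 3 case: (_ \in _).
  rewrite !big_split/= -betaE mul2n -addnn addnA; apply: leq_add.
    rewrite leq_add2r; apply: leq_add.
      rewrite (sum_slice F (fun t h => (t \in X) && (adj t h \in X))) /E /edges.
      rewrite [leqRHS](_ : _ = \sum_(t <- lamps F | t \in X) \sum_(g <- Q) (adj t g \in X)).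
        rewrite [leqRHS]big_mkcond/=; apply: leq_sum_fset => t tL.
        case: (t \in X) => /=; last by rewrite big1.
        apply: (leq_sum_fset_inj (h := id) (P := predT)) => // h.
        by rewrite in_slice => hF _; apply/imfsetP; exists (Shuffler t h).
      rewrite [RHS]big_fset_condE; apply: eq_fbigl => t; rewrite !inE.
      by case: (t \in lamps F).
    by apply: outflow_boundary; rewrite !inE eqxx.
  rewrite betaE.
  rewrite [leqLHS](_ : _ = \sum_(x <- F | (x * tau)%g \in F) (lamp (x * tau)%g \notin X)).
    apply: (leq_sum_fset_inj (h := fun x => (x * tau)%g)
      (fun x => nat_of_bool (lamp x \notin X))) => // x y _ _.
    exact: mulIg.
  by rewrite [RHS]big_mkcond/=; apply: eq_bigr => x _; case: (_ \in F); rewrite ?mul1n.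
have E2 : n <= 2 * E by lia.
have X_gt0 : 0 < #|` X|.
  rewrite cardfs_gt0; apply/eqP => X0; move: E2.
  by rewrite /E X0 /edges big_seq_fset0; lia.
have := edge_isoperimetry s0_neq1 Q X; rewrite -/E => isoE.
have sumX : \sum_(t <- X) #|` slice F t| <= n.
  rewrite /n card_fset_sum1 (sum_slice F (fun _ _ => 1)).
  rewrite [leqRHS](eq_bigr (fun t => #|` slice F t|)); last first.
    by move=> t _; rewrite card_fset_sum1.
  by apply: (leq_sum_fset_inj (h := id) (P := predT)) => // t; rewrite !inE => /andP[].
have Xn : #|` X| <= n.
  have Ln : #|` lamps F| <= n by exact: leq_imfset_card.
  apply: leq_trans Ln; apply: fsubset_leq_card.
  by apply/fsubsetP => t; rewrite !inE => /andP[].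
(* The contradiction: large slices make [2 ^ n] at least [(2 * n ^ 8) ^ |X|], but [n <= 2 * E] and
   edge isoperimetry bound it by [(n ^ 8) ^ |X|]. The exponent [8] is twice the [4] of
   [edge_isoperimetry]. *)
have : (2 * n ^ 8) ^ #|` X| <= 2 ^ n.
  apply: (@leq_trans (2 ^ (\sum_(t <- X) #|` slice F t|))); last by rewrite leq_exp2l.
  rewrite expn_sum (_ : _ ^ _ = \prod_(t <- X) (2 * n ^ 8)); last first.
    by rewrite big_const_seq count_predT iter_muln_1.
  by rewrite big_seq [leqRHS]big_seq; apply: leq_prod => t /XP /ltnW.
apply/negP; rewrite -ltnNge.
apply: (@leq_ltn_trans (2 ^ (2 * E))); first by rewrite leq_exp2l.
apply: (@leq_ltn_trans ((n ^ 8) ^ #|` X|)); last first.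
  by rewrite ltn_exp2r// -[ltnLHS]mul1n ltn_mul2r expn_gt0 n_gt0.
rewrite (_ : (n ^ 8) ^ #|` X| = (n ^ (4 * #|` X|)) ^ 2); last first.
  by rewrite -!expnM; congr expn; lia.
rewrite (mulnC 2) expnM leq_exp2r//; apply: leq_trans isoE _.
by rewrite leq_exp2r// muln_gt0.
Qed.

End Slices.

(** * Sets of permutations of large degree *)

Section TranspositionDegree.
Local Open Scope fset_scope.
Local Open Scope nat_scope.
Variable G : groupType.
Implicit Types (X Y : {fset finsym G}) (B : {fset G}) (s t : finsym G) (u w g : G).

(** Pairs are ordered and may be diagonal, so that degree and codegree add up to exactly
    [#|B| ^ 2]. *)
Definition degree B X s : nat := \sum_(u <- B) \sum_(w <- B) ((s * transp u w)%g \in X).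
Definition codegree B X s : nat := \sum_(u <- B) \sum_(w <- B) ((s * transp u w)%g \notin X).

Lemma degreeD B X s : degree B X s + codegree B X s = #|` B| ^ 2.
Proof.
rewrite /degree /codegree -big_split/= -mulnn -sum_fset_const; apply: eq_bigr => u _.
rewrite -big_split/= card_fset_sum1; apply: eq_bigr => w _.
by case: (_ \in X).
Qed.

Lemma mul_transp_eq s t u w : ((t * transp u w)%g == s) = (t == (s * transp u w)%g).
Proof. by apply/eqP/eqP => [<-|->]; rewrite transpK. Qed.

(** Deleting [s] removes its own missing pairs and turns into missing pairs those that led to [s];
    since transpositions are involutions, these are counted by [degree B X s]. *)
Lemma codegree_remove B X s : s \in X ->
  \sum_(t <- X `\ s) codegree B (X `\ s) t + codegree B X s <=
  \sum_(t <- X) codegree B X t + degree B X s.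
Proof.
move=> sX; rewrite (big_fsetD1 s sX)/= -addnA addnC leq_add2l.
have -> : degree B X s =
    \sum_(t <- X) \sum_(u <- B) \sum_(w <- B) ((t * transp u w)%g == s).
  rewrite exchange_big/=; apply: eq_bigr => u _.
  rewrite exchange_big/=; apply: eq_bigr => w _.
  under eq_bigr do rewrite mul_transp_eq.
  by rewrite -big_mkcond/= sum1_count count_uniq_mem ?fset_uniq.
rewrite [X in _ <= _ + X](big_fsetD1 s sX)/= [X in _ <= _ + X]addnC addnA.
apply: leq_trans (leq_addr _ _).
rewrite -big_split/=; apply: leq_sum_fset => t tX.
rewrite -big_split/=; apply: leq_sum => u _.
rewrite -big_split/=; apply: leq_sum => w _.
by rewrite !inE negb_and negbK; case: (_ == s); case: (_ \in X).
Qed.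

(* In a set with minimal ratio of boundary to size, deleting a vertex of
   degree well below one half of the total would decrease that ratio. *)
Lemma exists_min_degree B X : X != fset0 ->
  16 * (\sum_(s <- X) codegree B X s) <= #|` B| ^ 2 * #|` X| ->
  exists2 Y, Y `<=` X & Y != fset0 /\
    forall s, s \in Y -> 15 * #|` B| ^ 2 <= 32 * degree B Y s.
Proof.
have [v vE] : exists v, v = #|` B| ^ 2 by exists (#|` B| ^ 2).
rewrite -vE; have [n] := ubnP #|` X|; elim: n X => // n IH X leXn X0 le16.
have [all|] := pselect (forall s, s \in X -> 15 * v <= 32 * degree B X s).
  by exists X; [exact: fsubset_refl|split].
move=> /existsNP[s /not_implyP[sX /negP]]; rewrite -ltnNge => lt.
have cX := cardfsD1 s X; rewrite sX /= in cX.
have le1 := codegree_remove B sX; have := degreeD B X s; rewrite -vE => eq1.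
set Y := X `\ s in cX le1.
have [Y0|Y0] := eqVneq Y fset0.
  move: le16; rewrite (big_fsetD1 s sX)/= -/Y Y0 big_seq_fset0 cX Y0 cardfs0.
  by move=> ?; exfalso; lia.
have Yn : #|` Y| < n by move: leXn; rewrite cX ltnS add1n.
(* The deleted [s] has degree below [15 v / 32], hence codegree above [17 v / 32]. The codegree sum
   drops by more than [v / 16], which is what the right-hand side loses with one vertex. *)
have le16Y : 16 * (\sum_(t <- Y) codegree B Y t) <= v * #|` Y|.
  by move: le16; rewrite cX mulnDr muln1; move: #|` Y| => y; lia.
have [Z ZY ?] := IH Y Yn Y0 le16Y.
by exists Z => //; apply: fsubset_trans ZY _; exact: fsubD1set.
Qed.

(** By pigeonhole, a vertex [s] has some [u] in [B] with at least [q] choices of [w] keeping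
    [s * transp u w] in [X]. These take distinct values at [u], so fixing that value gives [q]
    disjoint nonempty parts of [X]. Each part, with [u] removed from [B], satisfies the hypothesis
    with [j] lowered by one. *)
Lemma card_ge_min_degree (V q j : nat) X B : X != fset0 ->
  0 < V -> #|` B| <= V -> (forall s, s \in X -> q * V + 2 * V * j <= degree B X s) ->
  q ^ j <= #|` X|.
Proof.
elim: j X B => [|j IH] X B X0 V_gt0 BV deg; first by rewrite expn0 cardfs_gt0.
have [->|q_gt0] := posnP q; first by rewrite exp0n.
have [s sX] := fset0Pn _ X0.
have [u uB qu] : exists2 u, u \in B & q <= \sum_(w <- B) ((s * transp u w)%g \in X).
  apply: contrapT => no; have := deg s sX; apply/negP; rewrite -ltnNge.
  apply: (@leq_ltn_trans (\sum_(u <- B) q.-1)).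
    apply: leq_sum_fset => u uB; rewrite -ltnS prednK// ltnNge; apply/negP => qu.
    by apply: no; exists u.
  by rewrite sum_fset_const; nia.
pose W := [fset w in B | (s * transp u w)%g \in X].
have qW : q <= #|` W| by rewrite card_fsetE_sum.
pose Xw w := [fset t in X | t u == s w].
have IHw w : w \in W -> q ^ j <= #|` Xw w|.
  rewrite !inE => /andP[wB sw]; apply: (IH _ (B `\ u)).
  - by apply/fset0Pn; exists (s * transp u w)%g; rewrite !inE sw finsym_mulE transpL /=.
  - exact: V_gt0.
  - by apply: leq_trans BV; apply: fsubset_leq_card; exact: fsubD1set.
  (* A transposition avoiding [u] preserves the value at [u], so only pairs containing [u] are lost,
     at most [2 * V] of them. *)
  move=> t; rewrite !inE => /andP[tX /eqP tu].
  suff : degree B X t <= degree (B `\ u) (Xw w) t + 2 * V by have := deg t tX; lia.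
  apply: (@leq_trans (\sum_(v <- B) \sum_(z <- B) (
      (v != u) * ((z != u) * ((t * transp v z)%g \in Xw w)) + ((v == u) + (z == u))))).
    apply: leq_sum => v _; apply: leq_sum => z _.
    have [//|vu] := eqVneq v u; first by case: (_ \in X).
    have [//|zu] := eqVneq z u; first by case: (_ \in X).
    by rewrite !inE finsym_mulE transpD 1?eq_sym// tu eqxx andbT !mul1n addn0.
  under eq_bigr do rewrite big_split/=.
  rewrite big_split/=; apply: leq_add.
    rewrite /degree (big_fsetD1 u uB)/= eqxx big1 ?add0n//.
    apply: leq_sum_fset => v; rewrite !inE => /andP[-> _].
    rewrite (big_fsetD1 u uB)/= eqxx !mul1n add0n.
    by apply: leq_sum_fset => z; rewrite !inE => /andP[-> _]; rewrite !mul1n.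
  under eq_bigr do rewrite big_split/=.
  have sum_eq : \sum_(z <- B) (z == u) = 1.
    by rewrite -big_mkcond/= sum1_count count_uniq_mem ?fset_uniq// uB.
  rewrite big_split/= [X in X + _ <= _]exchange_big/=.
  by under eq_bigr do rewrite sum_eq; rewrite !sum_fset_const; lia.
rewrite expnS; apply: (@leq_trans (#|` W| * q ^ j)); first by rewrite leq_mul2r qW orbT.
rewrite -sum_fset_const; apply: leq_trans (leq_sum_fset IHw) _.
under eq_bigr do rewrite card_fsetE_sum.
rewrite exchange_big/= [leqRHS]card_fset_sum1; apply: leq_sum => t _.
have [[w0 [w0W tw0]]|no] := pselect (exists w, w \in W /\ t u = s w); last first.
  by rewrite big1_fset// => w wW _; case: eqP => // tw; case: no; exists w.
rewrite tw0; under eq_bigr do rewrite (inj_eq (@finsym_inj _ s)) eq_sym.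
by rewrite -big_mkcond/= sum1_count count_uniq_mem ?fset_uniq// leq_b1.
Qed.

End TranspositionDegree.

(** * Transpositions as short words *)

Section Carry.
Local Open Scope fset_scope.
Local Open Scope nat_scope.
Variable G : groupType.
Variable S : {fset G}.
Implicit Types (g h s u w a b : G) (t : finsym G) (x : shuffler G).

Definition carry_moves : {fset shuffler G} :=
  [fset cursor_move s | s in S] `|` [fset lamp_move (transp 1%g s) | s in S].

Local Notation bd := (boundary carry_moves).

Lemma outflow_cursor F s : s \in S -> outflow F (cursor_move s) <= bd F.
Proof.
by move=> sS; apply: outflow_boundary; rewrite inE; apply/orP; left; apply/imfsetP; exists s.
Qed.

Lemma outflow_swap F s : s \in S -> outflow F (lamp_move (transp 1%g s)) <= bd F.
Proof.
by move=> sS; apply: outflow_boundary; rewrite inE; apply/orP; right; apply/imfsetP; exists s.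
Qed.

Lemma transp_conj t a b : (transp (t a) (t b) * t)%g = (t * transp a b)%g.
Proof.
apply: finsym_ext => g; rewrite !finsym_mulE !transpE /swap.
by rewrite !(inj_eq (@finsym_inj _ t)); case: (g == a) => //; case: (g == b).
Qed.

Lemma cursor_moveV s : (cursor_move s)^-1%g = cursor_move s^-1%g.
Proof.
by apply: (mulgI (cursor_move s)); rewrite mulgV mul_cursor_move /= mulgV.
Qed.

Lemma lamp_move_conj x a b :
  (x * lamp_move (transp ((cursor x)^-1 * a) ((cursor x)^-1 * b)) * x^-1)%g =
  lamp_move (transp (lamp x a) (lamp x b)).
Proof.
apply/(canLR (mulgK x)); rewrite mul_lamp_move act_transp !mulVKg.
by rewrite mul_shufflerE /shuffler_mul /= finsym_act1 mul1g transp_conj.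
Qed.

(* [Shuffler t w] is a product of moves "swap, then step", which carry the point
   [1] along a path from [1] to [w] inside the ball. Conjugating a single swap by
   it yields [transp 1 w'] for the next point [w'] of the path, provided that [w']
   is new: the word length is linear in [r] instead of quadratic. *)
Lemma carry r w : w \in word_ball S r -> exists t : finsym G,
  [/\ forall g, g \notin word_ball S r -> t g = g, t w = 1%g &
    forall F, outflow F (Shuffler t w) <= 2 * r * bd F].
Proof.
elim: r w => [|r IH] w.
  rewrite inE => /eqP ->; exists 1%g; split=> // F.
  by rewrite (_ : Shuffler _ _ = 1%g)// outflow1.
have sub g : g \notin word_ball S r.+1 -> g \notin word_ball S r.
  by apply: contra => gr; apply/word_ballSE; left.
move=> wr; have := wr; case/word_ballSE.
  move=> /IH[t [tr tw tF]]; exists t; split=> // [g /sub /tr//|F].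
  by apply: leq_trans (tF F) _; rewrite leq_mul2r leq_mul2l leqnSn !orbT.
move=> [h hr [s sS wE]]; have [t [tr tw tF]] := IH h hr.
exists (t * transp h w)%g; split.
- move=> g gr; rewrite finsym_mulE transpD ?tr ?sub//.
    by apply: contraNneq gr => ->; apply/word_ballSE; left.
  by apply: contraNneq gr => ->.
- by rewrite finsym_mulE transpR.
move=> F; have := outflow_cursor F sS; have := outflow_swap F sS; have := tF F.
suff : outflow F (Shuffler (t * transp h w)%g w) <= outflow F (Shuffler t h) +
    (outflow F (lamp_move (transp 1%g s)) + outflow F (cursor_move s)).
  move=> le leh les lec; apply: leq_trans le _.
  rewrite mulnS mulnDl addnC leq_add// mul2n -addnn; exact: leq_add.
case: wE => wE.
- rewrite [Shuffler _ w](_ : _ = Shuffler t h *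
    (lamp_move (transp 1%g s) * cursor_move s))%g.
    by apply: leq_trans (outflowM _ _ _) _; rewrite leq_add2l outflowM.
  by rewrite mulgA mul_lamp_move act_transp mul_cursor_move /= mulg1 -wE.
- rewrite [Shuffler _ w](_ : _ = Shuffler t h *
    ((cursor_move s)^-1 * lamp_move (transp 1%g s)))%g.
    apply: leq_trans (outflowM _ _ _) _; rewrite leq_add2l addnC.
    by rewrite -(outflowV _ (cursor_move s)) outflowM.
  rewrite mulgA cursor_moveV mul_cursor_move mul_lamp_move act_transp /=.
  by rewrite mulg1 -wE wE mulgVK -wE transpC.
Qed.

(** When [w] is new and has predecessor [h], the carry [Shuffler t h] satisfies [t h = 1] and
    [t w = w], so it conjugates the swap of [1] and [h^-1 * w] to [transp 1 w]. The carry and its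
    inverse cost [4 * r] together; the inner swap costs 1, or 3 for an inverse generator (step back,
    swap, step forth). *)
Lemma outflow_transp1 r w F : w \in word_ball S r ->
  outflow F (lamp_move (transp 1%g w)) <= (4 * r + 3) * bd F.
Proof.
elim: r w => [|r IH] w.
  by rewrite inE => /eqP ->; rewrite transpaa outflow1.
have [wr _|wr wr1] := boolP (w \in word_ball S r).
  by apply: leq_trans (IH w wr) _; rewrite leq_mul2r leq_add2r leq_mul2l leqnSn !orbT.
case/word_ballSE: wr1 => [|[h hr [s sS wE]]]; first by rewrite (negPf wr).
have [t [tr th tF]] := carry hr; have := tF F.
have := lamp_move_conj (Shuffler t h) h w; rewrite /= th (tr _ wr) => <-.
rewrite mulVg; set y := transp 1%g _.
have : outflow F (lamp_move y) <= 3 * bd F.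
  have := outflow_cursor F sS; have := outflow_swap F sS.
  rewrite /y; case: wE => ->; rewrite mulKg; first by lia.
  have -> : lamp_move (transp 1%g s^-1%g) = ((cursor_move s)^-1 *
      lamp_move (transp 1%g s) * cursor_move s)%g.
    rewrite cursor_moveV mul_cursor_move mul_lamp_move act_transp /=.
    by rewrite mulg1 !mulVg mul1g transpC.
  move=> sw cs; rewrite (_ : 3 * _ = bd F + bd F + bd F); last by lia.
  apply: leq_outflowM => //; apply: leq_outflowM => //.
  by rewrite outflowV.
move=> y3 tb.
apply: leq_trans (leq_outflowM (leq_outflowM tb y3) (b := 2 * r * bd F) _) _.
  by rewrite outflowV.
by rewrite -!mulnDl leq_mul2r; apply/orP; right; lia.
Qed.

(** [(u w) = (1 u)(1 w)(1 u)]: three transpositions, each of cost at most [4 * r + 3 <= 7 * r]. *)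
Lemma outflow_transp r u w F : 0 < r -> u \in word_ball S r -> w \in word_ball S r ->
  outflow F (lamp_move (transp u w)) <= 21 * r * bd F.
Proof.
move=> r_gt0 ur wr.
have Fu := outflow_transp1 F ur; have Fw := outflow_transp1 F wr.
have le : (4 * r + 3) * bd F <= 7 * r * bd F by rewrite leq_mul2r; apply/orP; right; lia.
have [->|uw] := eqVneq u w; first by rewrite transpaa outflow1.
have [w1|w1] := eqVneq w 1%g.
  by rewrite w1 transpC; apply: leq_trans Fu _; nia.
have -> : lamp_move (transp u w) = (lamp_move (transp 1%g u) *
    lamp_move (transp 1%g w) * lamp_move (transp 1%g u))%g.
  rewrite !mul_lamp_move /= !finsym_act1.
  have := transp_conj (transp 1%g u) 1%g w.
  rewrite transpL (transpD w1) 1?eq_sym// => <-.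
  by rewrite transpK.
apply: leq_trans (leq_outflowM (leq_outflowM Fu Fw) Fu) _.
by rewrite -!mulnDl leq_mul2r; apply/orP; right; lia.
Qed.

End Carry.

(** * Fibers over a cursor position, and the lower bound on size coming from balls *)

Section Fibers.
Local Open Scope fset_scope.
Local Open Scope nat_scope.
Variable G : groupType.
Implicit Types (F : {fset shuffler G}) (g u w : G) (t : finsym G).

Definition fiber F g := [fset lamp x | x in [fset x in F | cursor x == g]].

Lemma in_fiber F g t : (t \in fiber F g) = (Shuffler t g \in F).
Proof.
apply/imfsetP/idP => [[x /= ]|tF].
  by rewrite !inE => /andP[xF /eqP <-] ->; rewrite shuffler_eta.
by exists (Shuffler t g) => //=; rewrite !inE/= tF eqxx.
Qed.

Lemma sum_fiber F (f : finsym G -> G -> nat) :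
  \sum_(x <- F) f (lamp x) (cursor x) =
  \sum_(g <- [fset cursor x | x in F]) \sum_(t <- fiber F g) f t g.
Proof.
rewrite (partition_big_imfset _ (@cursor G)); apply: eq_fbigr => g _ _.
rewrite /fiber big_imfset/=; last first.
  move=> x y; rewrite !inE/= => /andP[_ /eqP cx] /andP[_ /eqP cy] lxy.
  by rewrite -(shuffler_eta x) -(shuffler_eta y) cx cy lxy.
by rewrite big_fset_condE; apply: eq_fbigr => x; rewrite !inE => /andP[_ /eqP ->].
Qed.

Lemma outflow_lamp_transp F u w :
  outflow F (lamp_move (transp u w)) = \sum_(g <- [fset cursor x | x in F])
    \sum_(t <- fiber F g) ((t * transp (g * u) (g * w))%g \notin fiber F g).
Proof.
rewrite -(sum_fiber F (fun t g => (t * transp (g * u) (g * w))%g \notin fiber F g)).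
by apply: eq_bigr => x _; rewrite mul_lamp_move act_transp in_fiber.
Qed.

Lemma shuffler_ball_profile (S : {fset G}) (r : nat) F : 0 < r -> F != fset0 ->
  336 * r * boundary (carry_moves S) F <= #|` F| ->
  (#|` word_ball S r| %/ 8) ^ (#|` word_ball S r| %/ 8) <= #|` F|.
Proof.
move=> r_gt0 F0 small; set B := word_ball S r.
set V := #|` B|; set K := [fset cursor x | x in F].
have V_gt0 : 0 < V.
  by rewrite cardfs_gt0; apply/fset0Pn; exists 1%g; exact: word_ball1.
pose gB g := [fset (g * u)%g | u in B].
have cgB g : #|` gB g| = V by rewrite card_imfset//; exact: mulgI.
have sum_gB g (f : G -> nat) : \sum_(u <- gB g) f u = \sum_(u <- B) f (g * u)%g.
  by rewrite big_imfset// => u w _ _; exact: mulgI.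
(* Double counting: at cursor [g] the move by [transp u w] swaps [g * u] and [g * w], so the
   outflows over all pairs of [B] add up to the missing pairs of [gB g] in the fibers. *)
have total : \sum_(g <- K) \sum_(t <- fiber F g) codegree (gB g) (fiber F g) t <=
    V ^ 2 * (21 * r * boundary (carry_moves S) F).
  apply: (@leq_trans (\sum_(u <- B) \sum_(w <- B) outflow F (lamp_move (transp u w)))).
    under [leqRHS]eq_bigr do under eq_bigr do rewrite outflow_lamp_transp.
    under [leqRHS]eq_bigr do rewrite exchange_big/=.
    rewrite [leqRHS]exchange_big/=; apply: leq_sum => g _.
    under [leqRHS]eq_bigr do rewrite exchange_big/=.
    rewrite [leqRHS]exchange_big/=; apply: leq_sum => t _.
    by rewrite /codegree sum_gB; apply: leq_sum => u _; rewrite sum_gB.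
  rewrite -mulnn -mulnA -!sum_fset_const; apply: leq_sum_fset => u uB.
  by apply: leq_sum_fset => w wB; exact: outflow_transp.
have cF : #|` F| = \sum_(g <- K) #|` fiber F g|.
  rewrite card_fset_sum1 (sum_fiber F (fun _ _ => 1)); apply: eq_bigr => g _.
  by rewrite card_fset_sum1.
(* As [336 = 16 * 21], the codegree is at most [V ^ 2 / 16] on average, and some fiber does no
   worse. The [+ 1] below keeps the contradiction strict. *)
have [g gK le16] : exists2 g, g \in K &
    16 * (\sum_(t <- fiber F g) codegree (gB g) (fiber F g) t) <= V ^ 2 * #|` fiber F g|.
  apply: contrapT => no.
  have : \sum_(g <- K) (V ^ 2 * #|` fiber F g| + 1) <=
      \sum_(g <- K) 16 * (\sum_(t <- fiber F g) codegree (gB g) (fiber F g) t).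
    apply: leq_sum_fset => g gK; rewrite addn1 ltnNge; apply/negP => le.
    by apply: no; exists g.
  rewrite big_split/= -!big_distrr/= -cF sum_fset_const muln1.
  have : 0 < #|` K|.
    have [x xF] := fset0Pn _ F0; rewrite cardfs_gt0; apply/fset0Pn.
    by exists (cursor x); apply/imfsetP; exists x.
  have : V ^ 2 * (336 * r * boundary (carry_moves S) F) <= V ^ 2 * #|` F|.
    by rewrite leq_mul2l small orbT.
  rewrite (_ : 336 * r * _ = 16 * (21 * r * boundary (carry_moves S) F)); last by lia.
  rewrite (mulnCA _ 16) => le K_gt0 le'.
  by have := leq_trans (leq_trans le' (leq_mul (leqnn 16) total)) le; lia.
have g0 : fiber F g != fset0.
  move: gK => /imfsetP[x /= xF ->]; apply/fset0Pn; exists (lamp x).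
  by rewrite in_fiber shuffler_eta.
rewrite -(cgB g) in le16; have [Y YX [Y0 deg]] := exists_min_degree g0 le16.
rewrite cgB in deg.
apply: (@leq_trans #|` Y|).
  (* With [j = q] the required degree is [3 * q * V], at most [3 V ^ 2 / 8], while [15 V ^ 2 / 32]
     is available. *)
  apply: (card_ge_min_degree Y0 V_gt0 (B := gB g)) => [|t tY]; first by rewrite cgB.
  have := deg t tY; have := leq_trunc_div V 8; set q := V %/ 8; rewrite -mulnn.
  by nia.
apply: leq_trans (fsubset_leq_card YX) _.
by apply: leq_trans (leq_imfset_card _ _ _) _; apply: fsubset_leq_card; exact: fset_sub.
Qed.

End Fibers.

(** * Energies of functions and isoperimetric profiles *)

Section FiniteSums.
Local Open Scope fset_scope.
Local Open Scope ring_scope.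
Variables (R : realType) (G : choiceType).
Implicit Types (f : G -> R) (D : {fset G}).

Lemma ler_sum_fset D f f' : (forall x, x \in D -> f x <= f' x) ->
  \sum_(x <- D) f x <= \sum_(x <- D) f' x.
Proof. by move=> le; rewrite big_seq [leRHS]big_seq; exact: ler_sum. Qed.

Lemma ler_sum_fset_sub D D' f : (forall x, 0 <= f x) -> D `<=` D' ->
  \sum_(x <- D) f x <= \sum_(x <- D') f x.
Proof.
move=> f0 DD'; rewrite [leRHS](big_fsetID _ (mem D))/=.
rewrite (_ : [fset x in D' | x \in D] = D) ?lerDl ?sumr_ge0//.
by apply/fsetP => x; rewrite !inE; apply/andP/idP => [[]//|xD]; rewrite (fsubsetP DD').
Qed.

Lemma fsbig_fsetE f D : (forall x, x \notin D -> f x = 0) ->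
  \sum_(x \in [set: G]) f x = \sum_(x <- D) f x.
Proof. by move=> fD; rewrite (fsbigTE D). Qed.

Lemma fsbig_ge0 f : (forall x, 0 <= f x) -> 0 <= \sum_(x \in [set: G]) f x.
Proof. by move=> f0; apply: sumr_ge0. Qed.

Lemma ler_sum_fsbig f D D' : (forall x, 0 <= f x) -> (forall x, x \notin D -> f x = 0) ->
  \sum_(x <- D') f x <= \sum_(x \in [set: G]) f x.
Proof.
move=> f0 fD; rewrite (@fsbig_fsetE _ (D `|` D')).
  by apply: ler_sum_fset_sub => //; exact: fsubsetUr.
by move=> x; rewrite inE negb_or => /andP[/fD].
Qed.

End FiniteSums.

Section FsetInjection.
Local Open Scope fset_scope.
Local Open Scope ring_scope.
Lemma ler_sum_fset_inj (R : realType) (I J : choiceType) (A : {fset I}) (B : {fset J})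
    (h : I -> J) (f : J -> R) : {in A &, injective h} -> (forall x, x \in A -> h x \in B) ->
  (forall y, 0 <= f y) -> \sum_(x <- A) f (h x) <= \sum_(y <- B) f y.
Proof.
move=> h_inj hB f0.
have -> : \sum_(x <- A) f (h x) = \sum_(y <- [fset h x | x in A]) f y.
  by rewrite big_imfset.
apply: ler_sum_fset_sub => //; apply/fsubsetP => y /imfsetP[x /= xA ->]; exact: hB.
Qed.

End FsetInjection.

Section Energy.
Local Open Scope fset_scope.
Local Open Scope ring_scope.
Variables (R : realType) (G : groupType).
Implicit Types (p x M : R) (S A D : {fset G}) (f : G -> R) (u w g : G).

Definition mass p f : R := \sum_(g \in [set: G]) `|f g| `^ p.
Definition energy p f w : R := \sum_(g \in [set: G]) `|f g - f (g * w)%g| `^ p.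
Definition energies p S f : R := \sum_(s <- S) energy p f s.

Lemma mass_ge0 p f : 0 <= mass p f.
Proof. by apply: fsbig_ge0 => g; exact: powR_ge0. Qed.

Lemma energy_ge0 p f w : 0 <= energy p f w.
Proof. by apply: fsbig_ge0 => g; exact: powR_ge0. Qed.

Lemma energies_ge0 p S f : 0 <= energies p S f.
Proof. by apply: sumr_ge0 => s _; exact: energy_ge0. Qed.

Definition widen D w : {fset G} := D `|` [fset (g * w^-1)%g | g in D].

Lemma widenP f D w g : (forall g, g \notin D -> f g = 0) -> g \notin widen D w ->
  f g = 0 /\ f (g * w)%g = 0.
Proof.
move=> fD; rewrite inE negb_or => /andP[gD gwD]; split; apply: fD => //.
by apply: contra gwD => gwD; apply/imfsetP; exists (g * w)%g; rewrite ?mulgK.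
Qed.

Lemma massE p f D : p != 0 -> (forall g, g \notin D -> f g = 0) ->
  mass p f = \sum_(g <- D) `|f g| `^ p.
Proof. by move=> p0 fD; apply: fsbig_fsetE => g /fD ->; rewrite normr0 powR0. Qed.

Lemma energyE p f D w : p != 0 -> (forall g, g \notin D -> f g = 0) ->
  energy p f w = \sum_(g <- widen D w) `|f g - f (g * w)%g| `^ p.
Proof.
move=> p0 fD; apply: fsbig_fsetE => g /(widenP fD)[-> ->].
by rewrite subrr normr0 powR0.
Qed.

Lemma le_energy p f D D' w : p != 0 -> (forall g, g \notin D -> f g = 0) ->
  \sum_(g <- D') `|f g - f (g * w)%g| `^ p <= energy p f w.
Proof.
move=> p0 fD; apply: (ler_sum_fsbig (D := widen D w)) => [g|g]; first exact: powR_ge0.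
by move=> /(widenP fD)[-> ->]; rewrite subrr normr0 powR0.
Qed.

Lemma norm_gradE p S f D : p != 0 -> (forall g, g \notin D -> f g = 0) ->
  norm_grad p S f = energies p S f `^ p^-1.
Proof.
move=> p0 fD; congr (_ `^ _).
pose E := \bigcup_(s <- S) widen D s.
have fE s : s \in S -> forall g, g \notin E -> `|f g - f (g * s)%g| `^ p = 0.
  move=> sS g gE; have [|-> ->] := @widenP _ D s g fD.
    apply: contra gE => gs; apply/bigfcupP; exists s => //; by rewrite sS.
  by rewrite subrr normr0 powR0.
rewrite (@fsbig_fsetE _ _ _ E); last first.
  by move=> g gE; apply: big1_fset => s sS _; exact: fE.
rewrite exchange_big/=; apply: eq_fbigr => s sS _; apply/esym/fsbig_fsetE.
exact: fE.
Qed.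

Lemma energyV p f w : energy p f w^-1%g = energy p f w.
Proof.
rewrite /energy (@reindex_fsbigT _ _ _ _ _ (fun g => g * w)%g)/=.
  by apply: eq_fsbigr => g _; rewrite mulgK distrC.
by exists (fun g => g * w^-1)%g => g; rewrite ?mulgK ?mulgVK.
Qed.

Lemma energy1 p f : p != 0 -> energy p f 1%g = 0.
Proof.
by move=> p0; apply: fsbig1 => g _; rewrite mulg1 subrr normr0 powR0.
Qed.

Lemma powR_normD p (a b : R) : 0 < p -> `|a + b| `^ p <= 2 `^ p * (`|a| `^ p + `|b| `^ p).
Proof.
move=> p_gt0; wlog ab : a b / `|a| <= `|b|.
  move=> W; have [/W//|/ltW /W] := leP `|a| `|b|.
  by rewrite addrC [X in _ * X]addrC.
apply: (@le_trans _ _ ((2 * `|b|) `^ p)).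
  rewrite ge0_ler_powR ?nnegrE ?mulr_ge0 ?(ltW p_gt0)//.
  by apply: le_trans (ler_normD _ _) _; rewrite mulr_natl mulr2n lerD2r.
by rewrite powRM// ler_wpM2l ?powR_ge0// lerDr powR_ge0.
Qed.

Lemma energyM p f D u w : 0 < p -> (forall g, g \notin D -> f g = 0) ->
  energy p f (u * w)%g <= 2 `^ p * (energy p f u + energy p f w).
Proof.
move=> p_gt0 fD; have p0 : p != 0 by rewrite gt_eqF.
rewrite (energyE _ p0 fD); set E := widen _ _.
pose v g := `|f (g * u)%g - f (g * u * w)%g| `^ p.
apply: (@le_trans _ _ (\sum_(g <- E) 2 `^ p * (`|f g - f (g * u)%g| `^ p + v g))).
  apply: ler_sum => g _; apply: le_trans (powR_normD _ _ p_gt0).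
  by rewrite mulgA addrA subrK.
rewrite -big_distrr/= big_split/= ler_wpM2l ?powR_ge0// lerD//.
  exact: le_energy p0 fD.
pose E' := [fset (g * u)%g | g in E].
apply: le_trans (le_energy E' w p0 fD).
apply: (@ler_sum_fset_inj _ _ _ _ _ (fun g => g * u)%g
  (fun g => `|f g - f (g * w)%g| `^ p)).
- by move=> g g' _ _; exact: mulIg.
- by move=> g gE; apply/imfsetP; exists g.
- by move=> g; exact: powR_ge0.
Qed.

(** Induction along the word by the quasi-triangle inequality [energyM]. The constant grows
    exponentially with the word, but it is fixed before [f] and its support. *)
Lemma energy_word p S r w : 0 < p -> w \in word_ball S r ->
  exists2 C, 0 <= C & forall f D, (forall g, g \notin D -> f g = 0) ->
    energy p f w <= C * energies p S f.
Proof.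
move=> p_gt0; have p0 : p != 0 by rewrite gt_eqF.
elim: r w => [|r IH] w.
  rewrite inE => /eqP ->; exists 0 => // f D fD.
  by rewrite energy1// mul0r.
case/word_ballSE => [/IH//|[h /IH[C C0 hC] [s sS wE]]].
exists (2 `^ p * (C + 1)) => [|f D fD].
  by rewrite mulr_ge0 ?powR_ge0// addr_ge0.
have les : energy p f s <= energies p S f.
  rewrite /energies (big_fsetD1 s sS)/= lerDl.
  by apply: sumr_ge0 => t _; exact: energy_ge0.
apply: (@le_trans _ _ (2 `^ p * (energy p f h + energy p f s))).
  by case: wE => ->; rewrite ?(energyV _ _ s) (le_trans (energyM _ _ _ fD))// energyV.
rewrite -mulrA ler_wpM2l ?powR_ge0// mulrDl mul1r lerD//; exact: hC fD.
Qed.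

Lemma energies_change p S T : 0 < p -> generates S ->
  exists2 C, 0 <= C & forall f D, (forall g, g \notin D -> f g = 0) ->
    energies p T f <= C * energies p S f.
Proof.
move=> p_gt0 gS; rewrite /energies.
elim: {T}(enum_fset T) => [|t T [C C0 IH]].
  by exists 0 => // f D _; rewrite big_nil mul0r.
have [r /(energy_word p_gt0)[C' C'0 tC]] := gS t.
exists (C' + C) => [|f D fD]; first exact: addr_ge0.
by rewrite big_cons mulrDl lerD//; [exact: tC fD|exact: IH fD].
Qed.

End Energy.

(** * Profiles as suprema over test functions *)

Section Profiles.
Local Open Scope fset_scope.
Local Open Scope ring_scope.
Variable (R : realType).
Implicit Types (p x y M C : R) (G : groupType).

Definition admissible G x (f : G -> R) : Prop :=
  [/\ forall g, 0 <= f g, exists g, f g != 0,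
      finite_set (supp f) & #|` fset_set (supp f)|%:R <= x].

Lemma admissibleP G x (f : G -> R) : admissible x f <->
  [/\ forall g, 0 <= f g, exists g, f g != 0 &
      exists2 D : {fset G}, forall g, (g \in D) = (f g != 0) & #|` D|%:R <= x].
Proof.
split=> [[f0 fn0 fin le]|[f0 fn0 [D Df le]]].
  split=> //; exists (fset_set (supp f)) => // g.
  by rewrite in_fset_set//; apply/idP/idP; rewrite inE.
have suppE : supp f = [set` D]%classic by apply/seteqP; split=> g /=; rewrite Df.
by split=> //; rewrite suppE ?set_fsetK//; exact: finite_fset.
Qed.

Lemma admissible_sub G x (f : G -> R) (D : {fset G}) : (forall g, 0 <= f g) ->
  (exists g, f g != 0) -> (forall g, g \notin D -> f g = 0) -> #|` D|%:R <= x ->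
  admissible x f.
Proof.
move=> f0 fn0 fD le; apply/admissibleP; split=> //.
exists [fset g in D | f g != 0] => [g|].
  by rewrite !inE /=; apply/andb_idl; apply: contraNT => /fD ->.
by apply: le_trans le; rewrite ler_nat fsubset_leq_card//; exact: fset_sub.
Qed.

Lemma admissible_le G x y (f : G -> R) : x <= y -> admissible x f -> admissible y f.
Proof. by move=> xy [? ? ? /le_trans]; split=> //; auto. Qed.

Lemma norm_lpE G p (f : G -> R) : norm_lp p f = mass p f `^ p^-1. Proof. by []. Qed.

Lemma norm_lp_gt0 G p (f : G -> R) x : 0 < p -> admissible x f -> 0 < norm_lp p f.
Proof.
move=> p_gt0 /admissibleP[f0 [g fg] [D Df _]]; rewrite norm_lpE; apply: powR_gt0.
rewrite (massE (D := D)) ?gt_eqF//; last by move=> h; rewrite Df negbK => /eqP.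
have gD : g \in D by rewrite Df.
rewrite (big_fsetD1 g gD)/= ltr_wpDr//.
  by apply: sumr_ge0 => h _; exact: powR_ge0.
by rewrite powR_gt0// normr_gt0.
Qed.

Lemma norm_grad_ge0 G p (S : {fset G}) (f : G -> R) : 0 <= norm_grad p S f.
Proof. exact: powR_ge0. Qed.

Lemma profile_ge G p (S : {fset G}) x (f : G -> R) : admissible x f ->
  ((norm_lp p f)%:E / (norm_grad p S f)%:E <= profile p S x)%E.
Proof. by move=> fx; apply: ereal_sup_ubound; exists f. Qed.

Lemma profile_mono G p (S : {fset G}) x y : x <= y -> (profile p S x <= profile p S y)%E.
Proof.
move=> xy; apply: ereal_sup_le => _ [f fx <-]; exists f => //.
exact: admissible_le xy fx.
Qed.

Lemma divE_ge0 (a b : R) : 0 <= a -> 0 <= b -> (0 <= a%:E / b%:E)%E.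
Proof. by move=> a0 b0; rewrite mule_ge0// inve_ge0 lee_fin. Qed.

(** Vanishing gradients are covered: if [b' = 0] the right side is [+oo], and [b = 0] is compatible
    with the inequality only when [b' = 0]. *)
Lemma divE_le_mul (a b a' b' C : R) : 0 < a -> 0 <= b -> 0 < a' -> 0 <= b' -> 0 < C ->
  a * b' <= C * a' * b -> (a%:E / b%:E <= C%:E * (a'%:E / b'%:E))%E.
Proof.
move=> a0 b0 a'0 b'0 C0 le.
have [b'E|b'n] := eqVneq b' 0.
  by rewrite b'E inve0 gt0_muley ?lte_fin// gt0_muley ?lte_fin// leey.
have b'_gt0 : 0 < b' by rewrite lt_neqAle eq_sym b'n.
have b_gt0 : 0 < b.
  rewrite lt_neqAle b0 andbT eq_sym; apply/eqP => bE.
  by move: le; rewrite bE mulr0 leNgt mulr_gt0.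
rewrite !inver !gt_eqF// -!EFinM lee_fin ler_pdivrMr// mulrA.
by rewrite mulrAC ler_pdivlMr.
Qed.

Lemma profile_le G p (S : {fset G}) x M : 0 < p ->
  (forall f : G -> R, admissible x f -> norm_lp p f <= M * norm_grad p S f) ->
  (profile p S x <= M%:E)%E.
Proof.
move=> p_gt0 le; apply: ge_ereal_sup => _ [f fx <-].
have lp0 := norm_lp_gt0 p_gt0 fx; have := le f fx.
have [->|gn] := eqVneq (norm_grad p S f) 0; first by rewrite mulr0 leNgt lp0.
have g0 : 0 < norm_grad p S f by rewrite lt_neqAle eq_sym gn norm_grad_ge0.
by move=> ?; rewrite inver gt_eqF// -EFinM lee_fin ler_pdivrMr.
Qed.

Lemma profile_ge0 G p (S : {fset G}) x : 0 < p -> 1 <= x -> (0 <= profile p S x)%E.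
Proof.
move=> p_gt0 x1.
have fx : admissible x (fun g : G => (g == 1%g)%:R : R).
  apply: (@admissible_sub _ _ _ [fset 1%g]) => [g|||].
  - by rewrite ler0n.
  - by exists 1%g; rewrite eqxx oner_eq0.
  - by move=> g; rewrite inE => /negPf ->.
  - by rewrite cardfs1.
apply: le_trans (profile_ge p S fx); apply: divE_ge0; last exact: norm_grad_ge0.
exact: powR_ge0.
Qed.

Lemma profile_le_mul G G' p p' (S : {fset G}) (S' : {fset G'}) x y C :
  0 < p -> 0 < p' -> 0 < C ->
  (forall F : G -> R, admissible x F -> exists2 f : G' -> R, admissible y f &
    norm_lp p F * norm_grad p' S' f <= C * norm_lp p' f * norm_grad p S F) ->
  (profile p S x <= C%:E * profile p' S' y)%E.
Proof.
move=> p0 p'0 C0 H; apply: ge_ereal_sup => _ [F Fx <-]; have [f fy le] := H F Fx.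
apply: le_trans (divE_le_mul (norm_lp_gt0 p0 Fx) (norm_grad_ge0 _ _ _)
  (norm_lp_gt0 p'0 fy) (norm_grad_ge0 _ _ _) C0 le) _.
by rewrite lee_pmul2l ?lte_fin//; exact: profile_ge.
Qed.

Lemma profile_change G p (S T : {fset G}) : 0 < p -> generates S ->
  exists2 C, 0 < C & forall x, (profile p S x <= C%:E * profile p T x)%E.
Proof.
move=> p_gt0 /(energies_change (R := R) T p_gt0)[C C0 CT].
exists ((1 + C) `^ p^-1) => [|x]; first by rewrite powR_gt0// ltr_pwDl.
apply: profile_le_mul => // [|F Fx]; first by rewrite powR_gt0// ltr_pwDl.
exists F => //; rewrite -mulrA mulrCA ler_wpM2l ?powR_ge0//.
have [_ _ [D Df _]] := (admissibleP _ _).1 Fx.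
have FD g : g \notin D -> F g = 0 by rewrite Df negbK => /eqP.
rewrite !(norm_gradE _ _ FD) ?gt_eqF// -powRM ?energies_ge0 ?addr_ge0//.
rewrite ge0_ler_powR ?nnegrE ?invr_ge0 ?(ltW p_gt0) ?mulr_ge0 ?addr_ge0 ?energies_ge0//.
by apply: le_trans (CT _ _ FD) _; rewrite ler_wpM2r ?energies_ge0// lerDr.
Qed.

End Profiles.

(** * From exponent [p] to exponent [1] *)

Section PowerInequalities.
Local Open Scope fset_scope.
Local Open Scope ring_scope.
Variable R : realType.
Implicit Types a b p t x y : R.

Lemma onem_exprn_le x n : 0 <= x <= 1 -> 1 - x ^+ n <= n%:R * (1 - x).
Proof.
move=> /andP[x0 x1]; elim: n => [|n IH]; first by rewrite expr0 mul0r subrr.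
have xn : x ^+ n <= 1 by rewrite exprn_ile1.
have : 0 <= (1 - x ^+ n) * (1 - x) by rewrite mulr_ge0 ?subr_ge0.
by rewrite exprS -natr1; move: (x ^+ n) IH => y; nra.
Qed.

(** With [r = b / a <= 1] and an integer [n >= p], Bernoulli gives
    [1 - r ^ p <= 1 - r ^ n <= n * (1 - r)]; multiplying by the [p]-th power of [a] concludes. *)
Lemma powR_sub_le p : 1 <= p -> exists2 N : R, 0 < N &
  forall a b, 0 <= a -> 0 <= b ->
    `|a `^ p - b `^ p| <= N * (`|a - b| * Num.max a b `^ (p - 1)).
Proof.
move=> p1; have p_gt0 : 0 < p by rewrite (lt_le_trans _ p1).
pose n := (Num.truncn p).+1.
have pn : p <= n%:R by rewrite ltW// truncnS_gt.
have n_gt0 : 0 < n%:R :> R by rewrite ltr0n.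
exists n%:R => // a b a0 b0; wlog ba : a b a0 b0 / b <= a.
  move=> W; have /orP[ba|ab] := le_total b a; first exact: W.
  by rewrite maxC distrC (distrC a); exact: W.
have ba' : b `^ p <= a `^ p by rewrite ge0_ler_powR ?nnegrE ?(ltW p_gt0).
rewrite (max_idPl ba) !ger0_norm ?subr_ge0//.
have [a_eq0|an] := eqVneq a 0.
  have -> : b = 0 by apply/eqP; rewrite eq_le b0 -a_eq0 ba.
  by rewrite a_eq0 subrr subrr mul0r mulr0.
have a_gt0 : 0 < a by rewrite lt_neqAle eq_sym an.
pose r := b / a.
have r0 : 0 <= r by rewrite divr_ge0.
have r1 : r <= 1 by rewrite ler_pdivrMr// mul1r.
have -> : b = a * r by rewrite /r mulrC divfK.
rewrite powRM// (_ : a - a * r = a * (1 - r)); last by rewrite mulrBr mulr1.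
rewrite (_ : a `^ p - _ = a `^ p * (1 - r `^ p)); last by rewrite mulrBr mulr1.
rewrite (_ : n%:R * _ = a * a `^ (p - 1) * (n%:R * (1 - r))); last by ring.
rewrite (mulr_powRB1 (ltW a_gt0) p_gt0) ler_wpM2l ?powR_ge0//.
apply: le_trans (onem_exprn_le n _); last by rewrite r0.
rewrite lerD2l lerN2; have [->|rn] := eqVneq r 0.
  by rewrite powR0 ?gt_eqF// expr0n.
rewrite -powR_mulrn// ger_powR// r1 andbT lt_neqAle eq_sym rn r0//.
Qed.

(* Once optimized over [t], this replaces Hoelder's inequality. *)
Lemma mul_powR_le p t x y : 1 <= p -> 0 < t -> 0 <= x -> 0 <= y ->
  x * y `^ (p - 1) <= y `^ p / t + t `^ (p - 1) * x `^ p.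
Proof.
move=> p1 t0 x0 y0; have p_gt0 : 0 < p by rewrite (lt_le_trans _ p1).
have [xy|yx] := leP (t * x) y.
  rewrite -[leLHS]addr0 lerD ?mulr_ge0 ?powR_ge0//.
  by rewrite ler_pdivlMr// mulrC mulrA -(mulr_powRB1 y0 p_gt0) ler_wpM2r ?powR_ge0.
rewrite -[leLHS]add0r lerD ?divr_ge0 ?powR_ge0 ?(ltW t0)//.
rewrite -(mulr_powRB1 x0 p_gt0) mulrCA ler_wpM2l//.
rewrite -powRM ?(ltW t0)// ge0_ler_powR ?nnegrE ?subr_ge0 ?mulr_ge0 ?(ltW t0)// ltW//.
Qed.

End PowerInequalities.

Section ProfileOne.
Local Open Scope fset_scope.
Local Open Scope ring_scope.
Variables (R : realType) (G : groupType).
Implicit Types (p x : R) (S A D : {fset G}) (f : G -> R).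

(** [powR_sub_le], then [mul_powR_le], on each difference. The [p]-th power of the larger value is
    at most the sum of both, so the mass enters twice per generator; hence [1 + 2 * #|S|]. *)
Lemma energies_powR p S : 1 <= p -> exists2 K : R, 0 < K &
  forall f D t, (forall g, 0 <= f g) -> (forall g, g \notin D -> f g = 0) -> 0 < t ->
    energies 1 S (fun g => f g `^ p) <=
    K * (mass p f / t + t `^ (p - 1) * energies p S f).
Proof.
move=> p1; have p_gt0 : 0 < p by rewrite (lt_le_trans _ p1).
have [N N_gt0 HN] := @powR_sub_le R p p1.
exists (N * (1 + 2 * #|` S|%:R)).
  by rewrite mulr_gt0// ltr_wpDr// mulr_ge0.
move=> f D t f0 fD t0.
have step s : energy 1 (fun g => f g `^ p) s <=
    N * (2 * mass p f / t + t `^ (p - 1) * energy p f s).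
  have pfD g : g \notin D -> f g `^ p = 0 by move=> /fD ->; rewrite powR0 ?gt_eqF.
  rewrite (energyE _ (oner_neq0 _) pfD); set E := widen _ _.
  apply: (@le_trans _ _ (\sum_(g <- E) N * ((`|f g| `^ p + `|f (g * s)%g| `^ p) / t +
      t `^ (p - 1) * `|f g - f (g * s)%g| `^ p))).
    apply: ler_sum => g _; rewrite powRr1//.
    apply: le_trans (HN _ _ (f0 g) (f0 (g * s)%g)) _.
    rewrite ler_wpM2l ?(ltW N_gt0)//.
    apply: le_trans (mul_powR_le p1 t0 _ _) _ => //.
      by rewrite le_max f0.
    rewrite lerD2r ler_wpM2r ?invr_ge0 ?(ltW t0)// !ger0_norm//.
    by rewrite /Num.max; case: ifP => _; rewrite ?lerDl ?lerDr powR_ge0.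
  rewrite -big_distrr/= ler_wpM2l ?(ltW N_gt0)// big_split/= lerD//.
    rewrite -big_distrl/= ler_wpM2r ?invr_ge0 ?(ltW t0)// big_split/=.
    rewrite mulr_natl mulr2n lerD//.
      apply: (ler_sum_fsbig (D := D)) => [g|g /fD ->]; first exact: powR_ge0.
      by rewrite normr0 powR0 ?gt_eqF.
    apply: (@le_trans _ _ (\sum_(g <- [fset (g * s)%g | g in E]) `|f g| `^ p)).
      apply: (@ler_sum_fset_inj _ _ _ _ _ (fun g => g * s)%g (fun g => `|f g| `^ p)).
      - by move=> g g' _ _; exact: mulIg.
      - by move=> g gE; apply/imfsetP; exists g.
      - by move=> g; exact: powR_ge0.
    apply: (ler_sum_fsbig (D := D)) => [g|g /fD ->]; first exact: powR_ge0.
    by rewrite normr0 powR0 ?gt_eqF.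
  by rewrite -big_distrr/= ler_wpM2l ?powR_ge0//; apply: le_energy fD; rewrite gt_eqF.
rewrite /energies; apply: le_trans (ler_sum_fset (fun s _ => step s)) _.
rewrite -big_distrr/= -[leRHS]mulrA ler_wpM2l ?(ltW N_gt0)// big_split/=.
rewrite -[X in _ + X]big_distrr/= -/(energies p S f).
rewrite big_const_seq count_predT iter_addr_0 -[X in X + _]mulr_natr.
set m := mass p f; set e := t `^ (p - 1) * _; set n := (size _)%:R.
have m0 : 0 <= m / t by rewrite divr_ge0 ?mass_ge0 ?(ltW t0).
have e0 : 0 <= e by rewrite mulr_ge0 ?powR_ge0 ?energies_ge0.
have n0 : 0 <= n by rewrite ler0n.
have -> : 2 * m / t * n = 2 * n * (m / t) by ring.
nra.
Qed.

End ProfileOne.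

Section Coarea.
Local Open Scope fset_scope.
Local Open Scope ring_scope.
Variables (R : realType) (G : groupType).
Implicit Types (p x : R) (S A D : {fset G}) (f : G -> R).

Lemma norm_lp1 f : norm_lp 1 f = mass 1 f.
Proof. by rewrite norm_lpE invr1 powRr1// mass_ge0. Qed.

Lemma norm_grad1 S f D : (forall g, g \notin D -> f g = 0) ->
  norm_grad 1 S f = energies 1 S f.
Proof. by move=> fD; rewrite (norm_gradE S (oner_neq0 _) fD) invr1 powRr1// energies_ge0. Qed.

Lemma profile_le_profile1 p S : 1 <= p ->
  exists2 C, 0 < C & forall x, (profile p S x <= C%:E * profile 1 S x)%E.
Proof.
move=> p1; have p_gt0 : 0 < p by rewrite (lt_le_trans _ p1).
have p0 : p != 0 by rewrite gt_eqF.
have [K K_gt0 HK] := energies_powR S p1.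
exists (2 * K) => [|x]; first by rewrite mulr_gt0.
apply: profile_le_mul => // [|F Fx]; first by rewrite mulr_gt0.
have [F0 [g0 Fg0] [D Df le]] := (admissibleP _ _).1 Fx.
have FD g : g \notin D -> F g = 0 by rewrite Df negbK => /eqP.
pose f g := F g `^ p.
have fD g : g \notin D -> f g = 0 by move=> /FD; rewrite /f => ->; rewrite powR0.
exists f.
  apply: admissible_sub fD le => [g|]; first exact: powR_ge0.
  by exists g0; rewrite powR_eq0 negb_and Fg0.
have f1 : mass 1 f = mass p F.
  rewrite (massE (oner_neq0 _) fD) (massE p0 FD); apply: eq_bigr => g _.
  by rewrite powRr1// ger0_norm ?powR_ge0// ger0_norm.
rewrite norm_lp1 f1 (norm_grad1 S fD) (norm_gradE S p0 FD) norm_lpE.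
have := norm_lp_gt0 p_gt0 Fx; rewrite norm_lpE; set mu := _ `^ _ => mu_gt0.
have muE : mass p F = mu `^ p.
  by rewrite /mu -powRrM mulVf// powRr1// mass_ge0.
set e := _ `^ p^-1; have e0 : 0 <= e by exact: powR_ge0.
have eE : energies p S F = e `^ p.
  by rewrite /e -powRrM mulVf// powRr1// energies_ge0.
have E1_ge0 : 0 <= energies 1 S f by exact: energies_ge0.
have mup : 0 < mu `^ p by exact: powR_gt0.
have {}HK t : 0 < t -> energies 1 S f <= K * (mu `^ p / t + t `^ (p - 1) * e `^ p).
  by rewrite -muE -eE; exact: HK F0 FD.
(* If the gradient of [F] vanishes, only the term in [1 / t] survives; a [t] that makes it half of
   [energies 1 S f] forces that energy to be zero. *)
rewrite muE; have [eE0|en] := eqVneq e 0.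
  suff -> : energies 1 S f = 0 by rewrite eE0 !mulr0.
  apply/eqP; apply: contraT => E1n.
  have E1_gt0 : 0 < energies 1 S f by rewrite lt_neqAle eq_sym E1n.
  have := HK (2 * K * mu `^ p / energies 1 S f).
  rewrite eE0 powR0// mulr0 addr0 !mulr_gt0 ?invr_gt0 ?mulr_gt0// => /(_ isT).
  set t := 2 * K * _ / _; have -> : mu `^ p / t = energies 1 S f / (2 * K).
    by rewrite /t; field; rewrite !gt_eqF.
  rewrite (_ : K * _ = energies 1 S f / 2); last by field; rewrite gt_eqF.
  by rewrite leNgt ltr_pdivrMr// ltr_pMr// ltr1n.
have e_gt0 : 0 < e by rewrite lt_neqAle eq_sym en.
(* [t = mu / e] balances the two terms: both become [mu ^ (p - 1) * e]. *)
have := HK (mu / e); rewrite divr_gt0// => /(_ isT) le1.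
apply: le_trans (ler_wpM2l (ltW mu_gt0) le1) _.
have -> : (mu / e) `^ (p - 1) * e `^ p = mu `^ p * e / mu.
  rewrite -(mulr_powRB1 e0 p_gt0) mulrCA -powRM ?divr_ge0 ?(ltW mu_gt0)//.
  rewrite divfK// -(mulr_powRB1 (ltW mu_gt0) p_gt0); field; by rewrite gt_eqF.
rewrite le_eqVlt; apply/orP; left; apply/eqP; field.
by rewrite !gt_eqF.
Qed.

(** * Indicators and level sets *)

Definition indic A : G -> R := fun g => (g \in A)%:R.

Lemma indicD A g : g \notin A -> indic A g = 0.
Proof. by rewrite /indic => /negPf ->. Qed.

Lemma indic_admissible A x : A != fset0 -> #|` A|%:R <= x -> admissible x (indic A).
Proof.
move=> /fset0Pn[a aA]; apply: admissible_sub (@indicD A) => [g|]; first by rewrite ler0n.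
by exists a; rewrite /indic aA oner_eq0.
Qed.

Lemma mass_indic A : mass 1 (indic A) = #|` A|%:R.
Proof.
rewrite (massE (oner_neq0 _) (@indicD A)) card_fset_sum1 natr_sum.
by apply: eq_fbigr => g gA _; rewrite /indic gA normr1 powRr1.
Qed.

Lemma energy_indic A s :
  (outflow A s)%:R <= energy 1 (indic A) s <= 2 * (outflow A s)%:R.
Proof.
rewrite (energyE _ (oner_neq0 _) (@indicD A)); set W := widen A s.
have -> : \sum_(g <- W) `|indic A g - indic A (g * s)%g| `^ 1 =
    (\sum_(g <- W) ((g \in A) && ((g * s)%g \notin A)) +
     \sum_(g <- W) ((g \notin A) && ((g * s)%g \in A)))%N%:R.
  rewrite -big_split/= natr_sum; apply: eq_bigr => g _; rewrite powRr1// /indic.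
  case: (g \in A); case: ((g * s)%g \in A) => /=.
  - by rewrite subrr normr0.
  - by rewrite subr0 normr1.
  - by rewrite sub0r normrN normr1.
  - by rewrite subrr normr0.
have -> : (\sum_(g <- W) ((g \in A) && ((g * s)%g \notin A)))%N = outflow A s.
  transitivity (\sum_(g <- A) ((g \in A) && ((g * s)%g \notin A)))%N.
    by apply/esym/big_fset_incl => [|g _ /negPf -> //]; exact: fsubsetUl.
  by apply: eq_fbigr => g gA _; rewrite gA.
set m := (\sum_(g <- W) _)%N; have mle : (m <= outflow A s)%N.
  rewrite -outflowV /m.
  rewrite [leqLHS](_ : _ = (\sum_(g <- W | (g * s)%g \in A) ((g * s * s^-1)%g \notin A))%N).
    by apply: (leq_sum_fset_inj (h := fun g => g * s)%g
      (fun g => nat_of_bool ((g * s^-1)%g \notin A))) => // x y _ _; exact: mulIg.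
  rewrite [RHS]big_mkcond/=; apply: eq_bigr => g _; rewrite mulgK.
  by case: ((g * s)%g \in A); rewrite ?andbT ?andbF.
by rewrite natrD lerDl ler0n/= mulr_natl mulr2n lerD2l ler_nat.
Qed.

Lemma energies_indic S A :
  (boundary S A)%:R <= energies 1 S (indic A) <= 2 * (boundary S A)%:R.
Proof.
rewrite /boundary natr_sum /energies big_distrr/=; apply/andP.
by split; apply: ler_sum => s _; have /andP[] := energy_indic A s.
Qed.

Lemma fset_argmin A (f : G -> R) : A != fset0 ->
  exists2 a, a \in A & forall g, g \in A -> f a <= f g.
Proof.
move=> /fset0Pn[a0 a0A].
case: (@Order.TotalTheory.arg_minP _ R A [` a0A] predT (fun z => f (val z)) isT) => a _ amin.
by exists (val a) => [|g gA]; [exact: valP|exact: (amin [` gA])].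
Qed.

(* Subtracting from [f] its minimum over its support removes one level set. *)
Lemma coarea_lt S (a b : R) D : 0 <= a -> 0 <= b ->
  (forall A, A `<=` D -> A != fset0 -> a * #|` A|%:R < b * energies 1 S (indic A)) ->
  forall f A, A `<=` D -> A != fset0 -> (forall g, 0 <= f g) ->
    (forall g, (g \in A) = (f g != 0)) -> a * mass 1 f < b * energies 1 S f.
Proof.
move=> a0 b0 H f A; have [n] := ubnP #|` A|; elim: n f A => // n IH f A An AD A0 f0 Af.
have fA g : g \notin A -> f g = 0 by rewrite Af negbK => /eqP.
have [z zA zmin] := fset_argmin f A0.
have m_gt0 : 0 < f z by rewrite lt_neqAle f0 andbT eq_sym -Af.
pose f' g := f g - f z * indic A g.
have f'A g : g \notin A -> f' g = 0 by move=> gA; rewrite /f' fA// indicD// mulr0 subrr.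
have f'0 g : 0 <= f' g.
  have [gA|gA] := boolP (g \in A); last by rewrite f'A.
  by rewrite /f' /indic gA mulr1 subr_ge0 zmin.
have massf : mass 1 f = f z * #|` A|%:R + mass 1 f'.
  rewrite -mass_indic (massE (oner_neq0 _) fA) (massE (oner_neq0 _) f'A).
  rewrite (massE (oner_neq0 _) (@indicD A)) big_distrr/= -big_split/=.
  apply: eq_fbigr => g gA _; rewrite !powRr1// !ger0_norm// ?ler0n//.
  by rewrite /f' addrC subrK.
have energyf s : energy 1 f s = f z * energy 1 (indic A) s + energy 1 f' s.
  rewrite (energyE _ (oner_neq0 _) fA) (energyE _ (oner_neq0 _) f'A).
  rewrite (energyE _ (oner_neq0 _) (@indicD A)) big_distrr/= -big_split/=.
  apply: eq_bigr => g _; rewrite !powRr1//.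
  have f'gs := f'0 (g * s)%g; have f'g := f'0 g.
  have [gA|gA] := boolP (g \in A); have [gsA|gsA] := boolP ((g * s)%g \in A).
  - by rewrite /f' /indic gA gsA subrr normr0 mulr0 add0r; congr `|_| => /=; ring.
  - rewrite (fA _ gsA) (f'A _ gsA) /indic gA (negPf gsA) !subr0 normr1 !ger0_norm//.
    by rewrite /f' /indic gA /=; ring.
  - rewrite (fA _ gA) (f'A _ gA) /indic gsA (negPf gA) !sub0r !normrN normr1 !ger0_norm//.
    by rewrite /f' /indic gsA /=; ring.
  - rewrite (fA _ gA) (fA _ gsA) (f'A _ gA) (f'A _ gsA) (indicD gA) (indicD gsA).
    by rewrite subrr normr0 mulr0 addr0.
have energiesf : energies 1 S f = f z * energies 1 S (indic A) + energies 1 S f'.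
  by rewrite /energies big_distrr/= -big_split/=; apply: eq_bigr => s _; exact: energyf.
rewrite massf energiesf !mulrDr ltr_leD//.
  by rewrite mulrCA (mulrCA b) ltr_pM2l// H.
pose A' := [fset g in A | f' g != 0].
have [A'0|A'0] := eqVneq A' fset0.
  have -> : mass 1 f' = 0.
    rewrite (massE (oner_neq0 _) f'A); apply: big1_fset => g gA _.
    have : g \notin A' by rewrite A'0 inE.
    by rewrite !inE gA/= negbK => /eqP ->; rewrite normr0 powR0// oner_neq0.
  by rewrite mulr0 mulr_ge0// energies_ge0.
have A'A : A' `<=` A by exact: fset_sub.
apply/ltW/(IH _ A') => //.
- have : A' `<` A.
    rewrite fproperEneq A'A andbT; apply/eqP => A'E.
    by move: zA; rewrite -A'E !inE /f' /indic => /andP[->]; rewrite mulr1 subrr eqxx.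
  by move/fproper_ltn_card; lia.
- exact: fsubset_trans A'A AD.
- move=> g; rewrite !inE/=; apply/andb_idl.
  by apply: contraNT => /f'A ->.
Qed.

(** If every set failed, [coarea_lt] with [a] the energy and [b] the mass of [f] would make their
    product smaller than itself. The strict inequality there allows this choice even when the energy
    is zero. *)
Lemma coarea S x f : admissible x f -> exists2 A, A != fset0 /\ #|` A|%:R <= x &
  mass 1 f * (boundary S A)%:R <= #|` A|%:R * energies 1 S f.
Proof.
move=> /admissibleP[f0 [g0 fg0] [D Df le]].
apply: contrapT => no.
suff : energies 1 S f * mass 1 f < mass 1 f * energies 1 S f by rewrite mulrC ltxx.
apply: (@coarea_lt S _ _ D _ _ _ f D) => //; [exact: energies_ge0|exact: mass_ge0| |].
- move=> A AD A0; rewrite mulrC ltNge; apply/negP => leA; apply: no; exists A.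
    by split=> //; apply: le_trans le; rewrite ler_nat fsubset_leq_card.
  apply: le_trans leA; rewrite ler_wpM2l ?mass_ge0//.
  by have /andP[] := energies_indic S A.
- by apply/fset0Pn; exists g0; rewrite Df.
Qed.

End Coarea.

(** * Lifting functions to the lampshuffler *)

Section SymmetricOn.
Local Open Scope fset_scope.
Local Open Scope ring_scope.
Variables (G : groupType) (D : {fset G}).
Implicit Types (t u : finsym G) (g h : G).

Let extend (phi : {ffun D -> D}) (g : G) : G := oapp (fun z => val (phi z)) g (insub g).

(** Cut out of the image of the finite type of self-maps of [D], which yields finiteness and the
    cardinality bound together; maps whose extension is not a bijection are sent to the identity. *)
Definition sym_on : {fset finsym G} :=
  [fset t in [fset insubd (1%g : finsym G) (extend phi) | phi in {ffun D -> D}]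
     | `[< forall g, g \notin D -> t g = g >] ].

Lemma sym_onP t : reflect (forall g, g \notin D -> t g = g) (t \in sym_on).
Proof.
apply: (iffP idP) => [|tD]; first by rewrite !inE => /andP[_ /asboolP].
rewrite !inE; apply/andP; split; last exact/asboolP.
have tDD g : g \in D -> t g \in D.
  move=> gD; apply: contraT => tgD; have /finsym_inj tg := tD _ tgD.
  by move: tgD; rewrite tg gD.
apply/imfsetP; exists [ffun z : D => [` tDD _ (valP z)] ] => //.
apply/finsym_ext => g; rewrite val_insubd.
set E := extend _; have EE : E = t.
  apply/funext => h; rewrite /E /extend; case: insubP => [z hD <-|hD] /=.
    by rewrite ffunE.
  by rewrite tD.
by rewrite EE finsym_funP.
Qed.

Lemma card_sym_on : (#|` sym_on| <= #|` D| ^ #|` D|)%N.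
Proof.
apply: leq_trans (fsubset_leq_card (fset_sub _ _)) _.
apply: leq_trans (leq_imfset_card _ _ _) _.
by rewrite -[size _]cardE card_ffun !cardfE.
Qed.

Lemma mem_sym_onM t u : u \in sym_on -> ((t * u)%g \in sym_on) = (t \in sym_on).
Proof.
move=> /sym_onP uD; apply/sym_onP/sym_onP => tD g gD; have := tD g gD.
  by rewrite finsym_mulE uD.
by rewrite finsym_mulE uD.
Qed.

Lemma sym_on1 : 1%g \in sym_on. Proof. by apply/sym_onP. Qed.

End SymmetricOn.

Section Lift.
Local Open Scope fset_scope.
Local Open Scope ring_scope.
Variables (R : realType) (G : groupType).
Implicit Types (t u : finsym G) (g h k : G) (x : shuffler G) (f : G -> R) (D : {fset G}).

Definition moved t : {fset G} := fset_set [set g | t g <> g]%classic.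

Lemma movedP t g : (g \in moved t) = (t g != g).
Proof.
rewrite /moved in_fset_set; last by case: t => s sP /=; case/asboolP: (sP).
by apply/idP/idP; rewrite inE /= => /eqP.
Qed.

Definition lift D f x : R := (lamp x \in sym_on D)%:R * f (cursor x).

Definition lift_support D : {fset shuffler G} :=
  [fset Shuffler t g | t in sym_on D, g in D].

Lemma sum_lift_support (V : nmodType) D (phi : finsym G -> G -> V) :
  \sum_(x <- lift_support D) phi (lamp x) (cursor x) =
  \sum_(t <- sym_on D) \sum_(g <- D) phi t g.
Proof. by rewrite big_imfset2//= => -[t g] [t' g'] _ _ /= [-> ->]. Qed.

Lemma liftD D f : (forall g, g \notin D -> f g = 0) ->
  forall x, x \notin lift_support D -> lift D f x = 0.
Proof.
move=> fD [t g]; rewrite /lift /=; apply: contraNeq; rewrite mulf_eq0 negb_or.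
rewrite pnatr_eq0 eqb0 negbK => /andP[tD fg]; apply/imfset2P; exists t => //.
by exists g => //; apply: contraNT fg => /fD ->.
Qed.

Lemma card_lift_support D : (#|` lift_support D| <= #|` D| ^ #|` D|.+1)%N.
Proof.
rewrite card_fset_sum1 (sum_lift_support _ (fun _ _ => 1%N)).
under eq_bigr do rewrite -card_fset_sum1.
by rewrite sum_fset_const expnSr leq_mul2r card_sym_on orbT.
Qed.

Lemma mass_lift p D f : p != 0 -> (forall g, g \notin D -> f g = 0) ->
  mass p (lift D f) = #|` sym_on D|%:R * mass p f.
Proof.
move=> p0 fD; rewrite (massE p0 (liftD fD)) (massE p0 fD).
rewrite (sum_lift_support _ (fun t g => `|(t \in sym_on D)%:R * f g| `^ p)).
rewrite card_fset_sum1 natr_sum big_distrl/=; apply: eq_fbigr => t tD _.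
by rewrite mul1r tD; apply: eq_bigr => g _; rewrite mul1r.
Qed.

(** If exactly one of the two lamps lies in [sym_on D], then [t], seen from [g], moves some [g * y]
    outside [D], where [f] vanishes. The surviving value [f h], with [h] equal to [g] or [g * k], is
    then itself the difference [f h - f (g * y)]. *)
Lemma lift_diff_le p D f t k x : p != 0 -> (forall g, g \notin D -> f g = 0) ->
  let g := cursor x in
  `|lift D f x - lift D f (x * Shuffler t k)%g| `^ p <=
  (lamp x \in sym_on D)%:R * (`|f g - f (g * k)%g| `^ p +
     \sum_(y <- moved t) `|f g - f (g * y)%g| `^ p) +
  ((lamp x * finsym_act g t)%g \in sym_on D)%:R *
     \sum_(y <- moved t) `|f (g * k)%g - f (g * y)%g| `^ p.
Proof.
move=> p0 fD; case: x => s g /=; rewrite mul_shufflerE /lift /shuffler_mul /=.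
set s' := (s * _)%g.
have sum0 h : 0 <= \sum_(y <- moved t) `|f h - f (g * y)%g| `^ p.
  by apply: sumr_ge0 => y _; exact: powR_ge0.
have exit : (s \in sym_on D) != (s' \in sym_on D) ->
    exists2 y, y \in moved t & f (g * y)%g = 0.
  move=> neq; apply: contrapT => no; move: neq; rewrite /s' mem_sym_onM ?eqxx//.
  apply/sym_onP => h hD /=; apply: contrapT => th; apply: no.
  exists (g^-1 * h)%g; last by rewrite mulVKg fD.
  by rewrite movedP; apply/eqP => e; apply: th; rewrite e mulVKg.
have le_exit h : (s \in sym_on D) != (s' \in sym_on D) ->
    `|f h| `^ p <= \sum_(y <- moved t) `|f h - f (g * y)%g| `^ p.
  move=> /exit[y yt fy]; rewrite (big_fsetD1 y yt)/= fy subr0 lerDl.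
  by apply: sumr_ge0 => z _; exact: powR_ge0.
move: le_exit; case: (s \in sym_on D); case: (s' \in sym_on D) => /= le_exit.
- by rewrite !mul1r -addrA lerDl addr_ge0.
- rewrite mul0r subr0 !mul1r mul0r addr0.
  by apply: le_trans (le_exit _ isT) _; rewrite lerDr powR_ge0.
- by rewrite mul0r sub0r normrN !mul1r mul0r add0r; exact: le_exit.
- by rewrite !mul0r subrr normr0 powR0// addr0.
Qed.

Lemma ler_sum_lamps_cursors (W : {fset shuffler G}) (phi : finsym G -> G -> R) :
  (forall t g, 0 <= phi t g) ->
  \sum_(x <- W) phi (lamp x) (cursor x) <=
  \sum_(g <- [fset cursor x | x in W]) \sum_(t <- lamps W) phi t g.
Proof.
move=> phi0; rewrite [leRHS]exchange_big/=.
pose P := [fset Shuffler t g | t in lamps W, g in [fset cursor x | x in W]].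
apply: (@le_trans _ _ (\sum_(x <- P) phi (lamp x) (cursor x))).
  apply: ler_sum_fset_sub => //; apply/fsubsetP => x xW; apply/imfset2P.
  exists (lamp x); first by apply/imfsetP; exists x.
  by exists (cursor x); [apply/imfsetP; exists x|rewrite shuffler_eta].
by rewrite big_imfset2//= => -[t g] [t' g'] _ _ /= [-> ->].
Qed.

(** At a fixed cursor each indicator selects at most [#|sym_on D|] lamps, the second one after a
    translation; this factor cancels against [mass_lift]. Differences between [g * k] and [g * y]
    are taken along [k^-1 * y]. *)
Lemma energy_lift p D f t k : p != 0 -> (forall g, g \notin D -> f g = 0) ->
  energy p (lift D f) (Shuffler t k) <= #|` sym_on D|%:R *
    (energy p f k + \sum_(y <- moved t) energy p f y
      + \sum_(y <- moved t) energy p f (k^-1 * y)%g).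
Proof.
move=> p0 fD; rewrite (energyE _ p0 (liftD fD)); set W := widen _ _.
set N : R := _%:R.
pose al g : R := `|f g - f (g * k)%g| `^ p + \sum_(y <- moved t) `|f g - f (g * y)%g| `^ p.
pose be g : R := \sum_(y <- moved t) `|f (g * k)%g - f (g * y)%g| `^ p.
have al0 g : 0 <= al g.
  by rewrite addr_ge0 ?powR_ge0//; apply: sumr_ge0 => y _; exact: powR_ge0.
have be0 g : 0 <= be g by apply: sumr_ge0 => y _; exact: powR_ge0.
apply: le_trans (ler_sum_fset (fun x _ => lift_diff_le t k x p0 fD)) _.
apply: le_trans (@ler_sum_lamps_cursors W (fun s g => (s \in sym_on D)%:R * al g +
   ((s * finsym_act g t)%g \in sym_on D)%:R * be g) _) _.
  by move=> s g; rewrite addr_ge0 ?mulr_ge0.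
set K := [fset cursor x | x in W].
apply: (@le_trans _ _ (\sum_(g <- K) (N * al g + N * be g))).
  apply: ler_sum => g _; rewrite big_split/= -!big_distrl/= -!natr_sum lerD//.
    rewrite ler_wpM2r// ler_nat card_fset_sum1 -big_mkcond/=.
    by apply: (leq_sum_fset_inj (h := id) (fun=> 1%N)).
  rewrite ler_wpM2r// ler_nat card_fset_sum1 -big_mkcond/=.
  apply: (leq_sum_fset_inj (h := fun s => s * finsym_act g t)%g (fun=> 1%N)) => //.
  by move=> s s' _ _; exact: mulIg.
rewrite big_split/= -!big_distrr/= -mulrDr ler_wpM2l ?ler0n// lerD//.
  rewrite big_split/= lerD ?(le_energy _ _ p0 fD)// exchange_big/=.
  by apply: ler_sum => y _; exact: le_energy p0 fD.
rewrite exchange_big/=; apply: ler_sum => y _.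
apply: le_trans (le_energy [fset (g * k)%g | g in K] (k^-1 * y)%g p0 fD).
rewrite [leLHS](eq_bigr (fun g => `|f (g * k)%g - f (g * k * (k^-1 * y))%g| `^ p)).
  apply: (@ler_sum_fset_inj _ _ _ _ _ (fun g => g * k)%g
    (fun g => `|f g - f (g * (k^-1 * y))%g| `^ p)).
  - by move=> g g' _ _; exact: mulIg.
  - by move=> g gE; apply/imfsetP; exists g.
  - by move=> g; exact: powR_ge0.
by move=> g _; rewrite mulgA mulgK.
Qed.

End Lift.

(** * Iterated lampshufflers *)

Section Iteration.
Local Open Scope fset_scope.
Local Open Scope ring_scope.
Variable R : realType.
Implicit Types (p : R) (G H : groupType).

(** [m ^ m] bounds the permutations of [m] points; the extra factor [m] is for the cursor. *)
Definition sym_size (m : nat) : nat := (m ^ m.+1)%N.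

Lemma profile_lift G p (T : {fset shuffler G}) : 0 < p ->
  exists (T' : {fset G}) (C : R), 0 < C /\ forall m : nat,
    (profile p T' m%:R <= C%:E * profile p T (sym_size m)%:R)%E.
Proof.
move=> p_gt0; have p0 : p != 0 by rewrite gt_eqF.
(* The directions occurring in [energy_lift]; [c] counts them with multiplicity. *)
pose dirs (x : shuffler G) := cursor x |` (moved (lamp x) `|`
  [fset ((cursor x)^-1 * y)%g | y in moved (lamp x)]).
pose T' := \bigcup_(z <- T) dirs z.
pose c (x : shuffler G) : R := 1 + #|` moved (lamp x)|%:R + #|` moved (lamp x)|%:R.
have c0 z : 0 <= c z by rewrite !addr_ge0.
pose C0 := \sum_(z <- T) c z; have C0_ge0 : 0 <= C0 by apply: sumr_ge0.
have C_gt0 : 0 < (1 + C0) `^ p^-1 by rewrite powR_gt0// ltr_pwDl.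
exists T', ((1 + C0) `^ p^-1); split=> // m; apply: profile_le_mul => // f fm.
have [f0 [g0 fg0] [D Df le]] := (admissibleP _ _).1 fm.
have fD g : g \notin D -> f g = 0 by rewrite Df negbK => /eqP.
have m_ge : (#|` D| <= m)%N by rewrite -(ler_nat R).
exists (lift D f).
  apply: admissible_sub (liftD fD) _ => [x||]; first by rewrite mulr_ge0.
    by exists (Shuffler 1%g g0); rewrite /lift /= sym_on1 mul1r.
  rewrite ler_nat; apply: leq_trans (card_lift_support D) _.
  have [D0|D_gt0] := posnP #|` D|; first by rewrite D0 exp0n.
  apply: (@leq_trans (m ^ #|` D|.+1)); first by rewrite leq_exp2r.
  by rewrite leq_pexp2l// (leq_trans D_gt0).
have dirE z y : z \in T -> y \in dirs z -> energy p f y <= energies p T' f.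
  move=> xT yx; have yT : y \in T' by apply/bigfcupP; exists z; rewrite ?xT.
  rewrite /energies (big_fsetD1 y yT)/= lerDl.
  by apply: sumr_ge0 => w _; exact: energy_ge0.
have leE : energies p T (lift D f) <= #|` sym_on D|%:R * ((1 + C0) * energies p T' f).
  apply: (@le_trans _ _ (#|` sym_on D|%:R * (C0 * energies p T' f))); last first.
    by rewrite ler_wpM2l// ler_wpM2r ?energies_ge0// lerDr.
  rewrite {1}/energies /C0 big_distrl big_distrr/=; apply: ler_sum_fset => x xT.
  rewrite -{1}(shuffler_eta x); apply: le_trans (energy_lift _ _ p0 fD) _.
  rewrite ler_wpM2l// /c !mulrDl mul1r !mulr_natl !lerD//.
  - by apply: dirE xT _; rewrite !inE eqxx.
  - rewrite -[leRHS]iter_addr_0 -count_predT -big_const_seq; apply: ler_sum_fset => y yx.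
    by apply: dirE xT _; rewrite !inE yx orbT.
  - rewrite -[leRHS]iter_addr_0 -count_predT -big_const_seq; apply: ler_sum_fset => y yx.
    apply: dirE xT _; rewrite !inE; apply/orP; right; apply/orP; right.
    by apply/imfsetP; exists y.
rewrite (norm_gradE _ p0 (liftD fD)) (norm_gradE _ p0 fD) !norm_lpE (mass_lift p0 fD).
rewrite -!powRM ?mulr_ge0 ?mass_ge0 ?energies_ge0 ?addr_ge0//.
rewrite ge0_ler_powR ?nnegrE ?invr_ge0 ?mulr_ge0 ?mass_ge0 ?energies_ge0 ?addr_ge0 ?(ltW p_gt0)//.
apply: le_trans (ler_wpM2l (mass_ge0 _ _) leE) _.
by rewrite le_eqVlt; apply/orP; left; apply/eqP; ring.
Qed.

Lemma profile_lift_iter n H p (T : {fset shuffler_iter n H}) : 0 < p ->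
  exists (T' : {fset H}) (C : R), 0 < C /\ forall m : nat,
    (profile p T' m%:R <= C%:E * profile p T (iter n sym_size m)%:R)%E.
Proof.
move=> p_gt0; elim: n T => [|n IH] T.
  by exists T, 1; split=> // m; rewrite mul1e.
have [T1 [C1 [C1_gt0 H1]]] := @profile_lift (shuffler_iter n H) p T p_gt0.
have [T' [C' [C'_gt0 H']]] := IH T1.
exists T', (C' * C1); split=> [|m]; first exact: mulr_gt0.
apply: le_trans (H' m) _; rewrite EFinM -muleA lee_pmul2l ?lte_fin//; exact: H1.
Qed.

(** This is [log2 (2 * y ^ 8)], the size bound of [shuffler_slice_profile]. *)
Definition log_size (y : R) : R := 1 + 8 / ln 2 * ln y.

Lemma ln2_gt0 : 0 < ln 2 :> R.
Proof. by rewrite ln_gt0// ltr1n. Qed.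

Lemma log_size_ge1 (y : R) : 1 <= y -> 1 <= log_size y.
Proof. by move=> y1; rewrite lerDl mulr_ge0 ?ln_ge0 ?divr_ge0 ?(ltW ln2_gt0). Qed.

Lemma iter_log_size_ge1 n (y : R) : 1 <= y -> 1 <= iter n log_size y.
Proof. by move=> y1; elim: n => //= n IH; exact: log_size_ge1. Qed.

Lemma card_le_log_size (a b : nat) (y : R) : (2 ^ a <= 2 * b ^ 8)%N -> (0 < b)%N ->
  b%:R <= y -> a%:R <= log_size y.
Proof.
move=> le b_gt0 by_; have b0 : 0 < b%:R :> R by rewrite ltr0n.
have y0 : 0 < y by exact: lt_le_trans by_.
have : ln ((2 ^ a)%N%:R : R) <= ln ((2 * b ^ 8)%N%:R : R).
  by rewrite ler_ln ?posrE ?ltr0n ?ler_nat ?muln_gt0 ?expn_gt0 ?b_gt0.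
rewrite natrM !natrX lnM ?posrE ?exprn_gt0// !lnXn// => leln.
have lnb : ln b%:R <= ln y by rewrite ler_ln ?posrE.
rewrite -(ler_pM2r ln2_gt0) /log_size mulrDl mul1r mulrAC divfK ?gt_eqF ?ln2_gt0//.
rewrite mulr_natl; apply: le_trans leln _; rewrite lerD2l -[leLHS]mulr_natl.
by rewrite ler_pM2l.
Qed.

Lemma slice_iter n H (S : {fset H}) :
  exists (U : {fset shuffler_iter n H}) (C : nat), forall (A : {fset shuffler_iter n H}) (y : R),
    A != fset0 -> #|` A|%:R <= y -> exists A' : {fset H}, [/\ A' != fset0,
      #|` A'|%:R <= iter n log_size y &
      (boundary S A' * #|` A| <= C * boundary U A * #|` A'|)%N].
Proof.
elim: n => [|n [U1 [C1 H1]]].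
  by exists S, 1%N => A y A0 Ay; exists A; split=> //; rewrite mul1n.
have [U [C2 H2]] := shuffler_slice_profile U1.
exists U, (C1 * C2)%N => A y A0 Ay.
have [A1 [A10 size1 bd1]] := H2 A A0.
have cA : (0 < #|` A|)%N by rewrite cardfs_gt0.
have cA1 : (0 < #|` A1|)%N by rewrite cardfs_gt0.
have [A' [A'0 size' bd']] := H1 A1 _ A10 (card_le_log_size size1 cA Ay).
exists A'; split=> //; first by rewrite iterSr.
rewrite -(leq_pmul2r cA1) mulnAC; apply: leq_trans (leq_mul bd' (leqnn _)) _.
rewrite (_ : _ * _ * _ * _ = C1 * #|` A'| * (boundary U1 A1 * #|` A|))%N; last by ring.
apply: leq_trans (leq_mul (leqnn _) bd1) _.
by rewrite leq_eqVlt; apply/orP; left; apply/eqP; ring.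
Qed.

(** A function is replaced by a level set, the level set by an iterated slice in [H], and the
    indicator of the slice is the test function. The [2] accounts for exits and entries in the
    energy of an indicator. *)
Lemma profile1_le_slices n H (S : {fset H}) :
  exists (U : {fset shuffler_iter n H}) (C : R), 0 < C /\ forall x : R,
    (profile 1 U x <= C%:E * profile 1 S (iter n log_size x))%E.
Proof.
have [U [C HU]] := slice_iter n S.
exists U, (1 + 2 * C%:R); split=> [|x]; first by rewrite ltr_pwDl ?mulr_ge0.
apply: profile_le_mul => // F Fx.
have [A [A0 Ax] leA] := coarea U Fx; have [A' [A'0 A'x bd']] := HU A x A0 Ax.
have [_ _ [D DF _]] := (admissibleP _ _).1 Fx.
have FD g : g \notin D -> F g = 0 by rewrite DF negbK => /eqP.
exists (indic R A'); first exact: indic_admissible.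
rewrite !norm_lp1 mass_indic (norm_grad1 S (indicD R (A:=A'))) (norm_grad1 U FD).
have /andP[_ leS] := energies_indic R S A'.
have cA : 0 < #|` A|%:R :> R by rewrite ltr0n cardfs_gt0.
have m0 := mass_ge0 1 F; have e0 := energies_ge0 1 U F.
apply: le_trans (ler_wpM2l m0 leS) _; rewrite -(ler_pM2r cA).
have {}bd' : (boundary S A')%:R * #|` A|%:R <= C%:R * (boundary U A)%:R * #|` A'|%:R :> R.
  by rewrite -!natrM ler_nat.
have a'0 : 0 <= #|` A'|%:R :> R by [].
have c'0 : 0 <= C%:R :> R by [].
move: leA bd' cA a'0 c'0; move: (mass 1 F) (energies 1 U F) (boundary S A')%:R
  (boundary U A)%:R #|` A|%:R #|` A'|%:R C%:R m0 e0.
move=> m e bS bU a a' c m0 e0 leA bd' a0 a'0 c0.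
apply: (@le_trans _ _ (2 * m * (c * bU * a'))).
  rewrite (_ : m * (2 * bS) * a = 2 * m * (bS * a)); last by ring.
  by rewrite ler_wpM2l// mulr_ge0.
apply: (@le_trans _ _ (2 * c * a' * (a * e))).
  rewrite (_ : 2 * m * (c * bU * a') = 2 * c * a' * (m * bU)); last by ring.
  by rewrite ler_wpM2l// !mulr_ge0.
rewrite -subr_ge0 (_ : _ - _ = a' * a * e); last by ring.
by rewrite !mulr_ge0// ltW.
Qed.

(** The passage to exponent 1 comes first, since level sets live there. Slicing dictates its own
    finite set [U], and [T] controls it because [T] generates. *)
Lemma profile_le_slices n H p (S : {fset H}) (T : {fset shuffler_iter n H}) :
  1 <= p -> generates T -> exists C : R, 0 < C /\ forall x : R,
    (profile p T x <= C%:E * profile 1 S (iter n log_size x))%E.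
Proof.
move=> p1 gT; have [C1 C1_gt0 H1] := profile_le_profile1 T p1.
have [U [C2 [C2_gt0 H2]]] := profile1_le_slices n S.
have [C3 C3_gt0 H3] := @profile_change R _ 1 T U ltr01 gT.
exists (C1 * (C3 * C2)); split=> [|x]; first by rewrite !mulr_gt0.
apply: le_trans (H1 x) _; rewrite EFinM -muleA lee_pmul2l ?lte_fin//.
apply: le_trans (H3 x) _; rewrite EFinM -muleA lee_pmul2l ?lte_fin//.
Qed.

End Iteration.

(** * Polynomial growth *)

Section Growth.
Local Open Scope fset_scope.
Local Open Scope ring_scope.
Variable R : realType.
Implicit Types (p : R) (H : groupType).

Lemma profile_le_ball n H p (S : {fset H}) (T : {fset shuffler_iter n (shuffler H)}) :
  1 <= p -> generates T -> exists C : R, 0 < C /\ forall (x : R) (r : nat), (0 < r)%N ->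
    iter n (@log_size R) x < ((#|` word_ball S r| %/ 8) ^ (#|` word_ball S r| %/ 8))%:R ->
    (profile p T x <= (C * r%:R)%:E)%E.
Proof.
move=> p1 gT; have [C [C_gt0 HC]] := profile_le_slices (carry_moves S) p1 gT.
have [c [c_gt0 Hc]] : exists c : nat, (0 < c)%N /\ forall (r : nat) A, (0 < r)%N ->
    A != fset0 -> (c * r * boundary (carry_moves S) A <= #|` A|)%N ->
    ((#|` word_ball S r| %/ 8) ^ (#|` word_ball S r| %/ 8) <= #|` A|)%N.
  by exists 336%N; split=> //; exact: shuffler_ball_profile.
exists (C * c%:R); split=> [|x r r_gt0]; first by rewrite mulr_gt0// ltr0n.
set y := iter n _ x => yq; apply: le_trans (HC x) _; rewrite -/y.
rewrite -mulrA EFinM lee_pmul2l ?lte_fin//; apply: profile_le => // f fy.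
have [A [A0 Ay] leA] := coarea (carry_moves S) fy.
have [_ _ [D DF _]] := (admissibleP _ _).1 fy.
have FD g : g \notin D -> f g = 0 by rewrite DF negbK => /eqP.
rewrite norm_lp1 (norm_grad1 _ FD).
have cA : 0 < #|` A|%:R :> R by rewrite ltr0n cardfs_gt0.
(* Otherwise the ball bound gives [A] at least [q ^ q] elements, [q] an eighth of the ball, whereas
   [A] has at most [y < q ^ q]. *)
have bdA : #|` A|%:R <= c%:R * r%:R * (boundary (carry_moves S) A)%:R :> R.
  rewrite -!natrM ler_nat ltnW// ltnNge; apply/negP => /(Hc _ _ r_gt0 A0).
  by rewrite -(ler_nat R) leNgt => /negP; apply; exact: le_lt_trans yq.
rewrite -(ler_pM2r cA); apply: le_trans (ler_wpM2l (mass_ge0 _ _) bdA) _.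
rewrite mulrCA -[leRHS]mulrA (mulrC (energies _ _ _)).
by rewrite ler_wpM2l// mulr_ge0.
Qed.

(** The tent function [max (k - |g|) 0], with [|g|] the word length. *)
Definition ball_height H (S : {fset H}) (k : nat) (g : H) : nat :=
  \sum_(0 <= i < k) (g \in word_ball S i).

Lemma word_ball_mono H (S : {fset H}) i j g : (i <= j)%N ->
  g \in word_ball S i -> g \in word_ball S j.
Proof.
move=> /subnK <-; elim: (j - i)%N => [//|m IH] gi; rewrite addSn.
by apply/word_ballSE; left; exact: IH.
Qed.

Lemma ball_height_le H (S : {fset H}) k g h :
  (forall i, g \in word_ball S i -> h \in word_ball S i.+1) ->
  (ball_height S k g <= (ball_height S k h).+1)%N.
Proof.
move=> gh; apply: (@leq_trans (\sum_(0 <= i < k) (h \in word_ball S i.+1))%N).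
  apply: leq_sum => i _; case: (boolP (g \in _)) => // /gh ->//.
rewrite -(@big_add1 _ _ _ 0%N k.+1 xpredT (fun i => nat_of_bool (h \in word_ball S i))).
apply: (@leq_trans (\sum_(0 <= i < k.+1) (h \in word_ball S i))%N).
  by rewrite [leqRHS]big_ltn// leq_addl.
rewrite /ball_height big_nat_recr//= -addn1 leq_add2l; exact: leq_b1.
Qed.

(** The tent of height [2 * k] is 1-Lipschitz, at least [k] on the ball of radius [k], and supported
    in the ball of radius [2 * k], which polynomial growth makes comparable in size. *)
Lemma profile_ge_ball H p (S : {fset H}) d : 0 < p -> polynomial_growth S d ->
  exists (K : nat) (C : R), [/\ (0 < K)%N, 0 < C & forall k : nat, (0 < k)%N ->
    (k%:R%:E <= C%:E * profile p S (K * k ^ d)%:R)%E].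
Proof.
move=> p_gt0 [K K_gt0 HK]; have p0 : p != 0 by rewrite gt_eqF.
(* Each energy is at most [2 * #|D|], and [#|D|] at most [K * 2 ^ d * k ^ d]; the last [K] turns
   [k ^ d] into the size of the ball of radius [k]. *)
pose B : nat := (#|` S| * (2 * (K * 2 ^ d)) * K)%N.
exists (K * 2 ^ d)%N, ((1 + B%:R) `^ p^-1).
have C_gt0 : 0 < (1 + B%:R : R) `^ p^-1 by rewrite powR_gt0// ltr_pwDl.
split=> [||k k_gt0]; [by rewrite muln_gt0 K_gt0 expn_gt0|exact: C_gt0|].
pose f g : R := (ball_height S (2 * k) g)%:R; pose D := word_ball S (2 * k).
have fD g : g \notin D -> f g = 0.
  move=> gD; rewrite /f /ball_height big_nat_cond big1// => i /andP[/andP[_ ik] _].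
  by apply/eqP; rewrite eqb0; apply: contra gD; apply: word_ball_mono; exact: ltnW.
have f_ge g : g \in word_ball S k -> k%:R <= f g.
  move=> gk; rewrite ler_nat /ball_height (big_cat_nat (n := k))//=; last by lia.
  apply: (@leq_trans (\sum_(k <= i < 2 * k) 1)%N).
    by rewrite sum_nat_const_nat muln1; lia.
  rewrite [leqRHS]addnC; apply: leq_trans (leq_addr _ _).
  rewrite big_nat [leqRHS]big_nat; apply: leq_sum => i /andP[ki _].
  by rewrite (word_ball_mono ki gk).
have cD : (#|` D| <= K * 2 ^ d * k ^ d)%N.
  by rewrite -mulnA -expnMn; apply: (HK _ _).2; rewrite muln_gt0.
have fx : admissible (K * 2 ^ d * k ^ d)%:R f.
  apply: (admissible_sub _ _ fD) => [g||]; [exact: ler0n| |by rewrite ler_nat].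
  exists 1%g; have := f_ge _ (word_ball1 S k).
  by move=> le; rewrite gt_eqF//; apply: lt_le_trans le; rewrite ltr0n.
have diff g s : s \in S -> `|f g - f (g * s)%g| <= 1.
  move=> sS; rewrite /f.
  have le1 : (ball_height S (2 * k) g <= (ball_height S (2 * k) (g * s)%g).+1)%N.
    apply: ball_height_le => i gi; apply/word_ballSE; right; exists g => //.
    by exists s => //; left.
  have le2 : (ball_height S (2 * k) (g * s)%g <= (ball_height S (2 * k) g).+1)%N.
    apply: ball_height_le => i gi; apply/word_ballSE; right; exists (g * s)%g => //.
    by exists s => //; right; rewrite mulgK.
  move: le1 le2; rewrite -!(ler_nat R) -!natr1 ler_norml => le1 le2.
  by apply/andP; split; lra.
have energy_le s : s \in S -> energy p f s <= (2 * #|` D|)%:R.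
  move=> sS; rewrite (energyE s p0 fD).
  apply: (@le_trans _ _ (\sum_(g <- widen D s) 1)).
    apply: ler_sum => g _; rewrite [leRHS](_ : 1 = 1 `^ p); last by rewrite powR1.
    by rewrite ge0_ler_powR ?nnegrE ?(ltW p_gt0)//; exact: diff.
  rewrite (_ : \sum_(g <- widen D s) 1 = #|` widen D s|%:R); last first.
    by rewrite card_fset_sum1 natr_sum.
  rewrite ler_nat mul2n -addnn.
  apply: leq_trans (leq_card_fsetU _ _) _; rewrite leq_add2l; exact: leq_imfset_card.
have mass_ge : k%:R `^ p * #|` word_ball S k|%:R <= mass p f.
  rewrite (massE p0 fD) card_fset_sum1 natr_sum big_distrr/=.
  apply: (@le_trans _ _ (\sum_(g <- word_ball S k) `|f g| `^ p)).
    apply: ler_sum_fset => g gk; rewrite mulr1 ge0_ler_powR ?nnegrE ?(ltW p_gt0)//.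
    by apply: le_trans (f_ge g gk) (ler_norm _).
  apply: ler_sum_fset_sub => [g|]; first exact: powR_ge0.
  by apply/fsubsetP => g; apply: word_ball_mono; lia.
have energies_le : energies p S f <= (#|` S| * (2 * (K * 2 ^ d * k ^ d)))%:R.
  apply: (@le_trans _ _ (\sum_(s <- S) (2 * #|` D|)%:R)).
    by apply: ler_sum_fset => s sS; exact: energy_le.
  by rewrite -natr_sum ler_nat sum_fset_const leq_mul2l leq_mul2l cD !orbT.
apply: (@le_trans _ _ (((1 + B%:R) `^ p^-1)%:E *
    ((norm_lp p f)%:E / (norm_grad p S f)%:E))%E); last first.
  by rewrite lee_pmul2l ?lte_fin//; exact: profile_ge.
have -> : k%:R%:E = (k%:R%:E / 1%:E)%E :> \bar R by rewrite inver oner_eq0 invr1 mule1.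
apply: divE_le_mul => //; [by rewrite ltr0n|exact: norm_lp_gt0 p_gt0 fx|exact: powR_ge0|].
rewrite mulr1 (norm_gradE S p0 fD) norm_lpE -powRM ?mass_ge0 ?addr_ge0//.
have -> : k%:R = (k%:R `^ p) `^ p^-1 :> R by rewrite -powRrM mulfV// powRr1.
rewrite -powRM ?powR_ge0 ?energies_ge0//.
rewrite ge0_ler_powR ?nnegrE ?invr_ge0 ?mulr_ge0 ?mass_ge0 ?energies_ge0 ?addr_ge0
  ?powR_ge0 ?(ltW p_gt0)//.
apply: (@le_trans _ _ (B%:R * mass p f)); last first.
  by rewrite ler_wpM2r ?mass_ge0// lerDr.
apply: le_trans (ler_wpM2l _ mass_ge) => //.
rewrite mulrCA; apply: ler_wpM2l; first exact: powR_ge0.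
apply: le_trans energies_le _; rewrite -natrM ler_nat /B.
rewrite -(mulnA _ K) (_ : (_ * (2 * _))%N = #|` S| * (2 * (K * 2 ^ d)) * k ^ d)%N.
  by rewrite leq_mul// (HK k k_gt0).1.
by rewrite !mulnA.
Qed.

End Growth.

(** * Asymptotics *)

Section Logarithms.
Local Open Scope fset_scope.
Local Open Scope ring_scope.
Variable R : realType.
Implicit Types (x y Y Z M w : R).

Lemma iter_lnS n x : iter_ln n.+1 x = ln (iter_ln n x). Proof. by []. Qed.

Lemma iter_ln_large n M : exists X, forall x, X <= x -> forall j, (j <= n)%N -> M <= iter_ln j x.
Proof.
elim: n M => [|n IH] M.
  by exists M => x Mx j; rewrite leqn0 => /eqP ->.
have [X HX] := IH (Num.max M (expR M)); exists X => x Xx j.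
rewrite leq_eqVlt => /orP[/eqP ->|jn]; last first.
  by apply: le_trans (HX x Xx j jn); rewrite le_max lexx.
have le : expR M <= iter_ln n x by apply: le_trans (HX x Xx n (leqnn n)); rewrite le_max lexx orbT.
by rewrite iter_lnS -[leLHS]expRK ler_ln// posrE ?expR_gt0// (lt_le_trans _ le)// expR_gt0.
Qed.

(** Square [1 + Z / 4 <= expR (Z / 4)]; the quadratic inequality [2 * Z <= (1 + Z / 4) ^ 2] holds
    for [Z >= 24], which is the origin of the threshold 24. *)
Lemma double_le_expR_half Z : 24 <= Z -> 2 * Z <= expR (Z / 2).
Proof.
move=> Z24; have e1 : 1 + Z / 4 <= expR (Z / 4) by exact: expR_ge1Dx.
have -> : expR (Z / 2) = expR (Z / 4) ^+ 2.
  by rewrite expr2 -expRD; congr expR; lra.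
have e0 : 0 <= 1 + Z / 4 by lra.
by apply: (@le_trans _ _ ((1 + Z / 4) ^+ 2)); [nra|rewrite lerXn2r ?nnegrE// expR_ge0].
Qed.

Lemma expR_half_le_div_ln Y : 24 <= ln Y -> expR (ln Y / 2) <= Y / ln Y.
Proof.
move=> L24; have Y0 : 0 < Y by rewrite ltNge; apply/negP => /ln0 H; move: L24; rewrite H; lra.
have L0 : 0 < ln Y by lra.
rewrite ler_pdivlMr// -[leRHS](lnK (x := Y)) ?posrE//.
rewrite [X in _ <= expR X](_ : ln Y = ln Y / 2 + ln Y / 2); last by lra.
rewrite expRD ler_wpM2l ?expR_ge0//.
by have := double_le_expR_half L24; lra.
Qed.

Lemma sym_size_le m w : (0 < m)%N -> m%:R <= w -> (sym_size m)%:R <= expR (2 * w * ln w).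
Proof.
move=> m_gt0 mw; have m0 : 0 < m%:R :> R by rewrite ltr0n.
have m1 : 1 <= m%:R :> R by rewrite ler1n.
have w0 : 0 < w by exact: lt_le_trans mw.
rewrite /sym_size natrX -[leLHS](lnK (x := _)) ?posrE ?exprn_gt0// lnXn// ler_expR.
rewrite -[leLHS]mulr_natl; apply: ler_pM => //; first by rewrite ln_ge0.
  by rewrite -natr1; lra.
by rewrite ler_ln ?posrE.
Qed.

(** The invariant of the iteration: a number below the square root of [expR Z] is sent below the
    square root of [expR (expR Z)], so the factor [ln] in the exponent does not accumulate. *)
Lemma sym_size_expR m Z : 24 <= Z -> (0 < m)%N -> m%:R <= expR (Z / 2) ->
  (sym_size m)%:R <= expR (expR Z / 2).
Proof.
move=> Z24 m_gt0 mZ; apply: le_trans (sym_size_le m_gt0 mZ) _.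
rewrite expRK ler_expR [X in _ <= expR X / _](_ : Z = Z / 2 + Z / 2); last by lra.
have := double_le_expR_half Z24; have := expR_gt0 (Z / 2).
by rewrite expRD; nra.
Qed.

Lemma sym_size_gt0 m : (0 < m)%N -> (0 < sym_size m)%N.
Proof. by move=> m0; rewrite expn_gt0 m0. Qed.

Lemma iter_ln_exp n x : 24 <= iter_ln n x -> expR (iter_ln n.+1 x) = iter_ln n x.
Proof. by move=> le; rewrite iter_lnS lnK// posrE; lra. Qed.

Lemma iter_sym_size_expR n m x : (forall j, (j <= n.+1)%N -> 24 <= iter_ln j x) ->
  (0 < m)%N -> m%:R <= expR (iter_ln n.+1 x / 2) ->
  (iter n sym_size m)%:R <= expR (ln x / 2).
Proof.
elim: n m => [//|n IH] m Hx m_gt0 mle; rewrite iterSr; apply: IH.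
- by move=> j jn; apply: Hx; exact: leqW.
- exact: sym_size_gt0.
- rewrite -(iter_ln_exp (Hx n.+1 _))//; apply: sym_size_expR => //; exact: Hx.
Qed.

(** With [w = Y / (4 * L)], the first step gives at most [expR (2 * w * L) = expR (Y / 2)]. The
    factor 4 is what reaches this square root, and the remaining steps preserve it. *)
Lemma iter_sym_size_le n m x : (forall j, (j <= n.+1)%N -> 24 <= iter_ln j x) ->
  (0 < m)%N -> m%:R <= iter_ln n x / (4 * iter_ln n.+1 x) ->
  (iter n sym_size m)%:R <= x.
Proof.
move=> Hx m_gt0; have L24 := Hx n.+1 (leqnn _); have Y24 := Hx n (leqnSn _).
set Y := iter_ln n x in Y24 *; set L := iter_ln n.+1 x in L24 * => mle.
have w0 : 0 < Y / (4 * L) by rewrite divr_gt0//; lra.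
have wY : Y / (4 * L) <= Y by rewrite ler_pdivrMr; nra.
have x24 : 24 <= x by exact: (Hx 0%N).
have lnx : 24 <= ln x by exact: (Hx 1%N).
case: n => [|n] in Hx Y L L24 Y24 mle w0 wY *; first exact: le_trans mle wY.
rewrite iterSr; apply: (@le_trans _ _ (expR (ln x / 2))).
  apply: iter_sym_size_expR; last 1 first.
  - apply: le_trans (sym_size_le m_gt0 mle) _; rewrite ler_expR.
    have lnw : ln (Y / (4 * L)) <= L by rewrite ler_ln ?posrE//; exact: lt_le_trans Y24.
    apply: (@le_trans _ _ (2 * (Y / (4 * L)) * L)).
      by rewrite ler_wpM2l// mulr_ge0// ltW.
    rewrite -/Y le_eqVlt; apply/orP; left; apply/eqP; field.
    by rewrite gt_eqF//; lra.
  - by move=> j jn; apply: Hx; exact: leqW.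
  - exact: sym_size_gt0.
by rewrite -[leRHS](lnK (x := x)) ?posrE ?ler_expR; lra.
Qed.

(** The additive constants of each level are absorbed into [C], because the iterated logarithm is
    eventually at least 1. *)
Lemma iter_log_size_le n : exists C : R, 0 < C /\
  exists X, forall x, X <= x -> iter n (@log_size R) x <= C * iter_ln n x.
Proof.
elim: n => [|n [C [C_gt0 [X HX]]]].
  by exists 1; split=> //; exists 0 => x _; rewrite mul1r.
pose c : R := 8 / ln 2; have c0 : 0 < c by rewrite divr_gt0// ln2_gt0.
have [X' HX'] := iter_ln_large n.+1 1.
exists (1 + c * (`|ln C| + 1)); split.
  by rewrite ltr_wpDr// mulr_ge0 ?(ltW c0)// addr_ge0.
exists (Num.max 1 (Num.max X X')) => x; rewrite !ge_max => /and3P[x1 Xx X'x].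
have Y1 := HX' x X'x n (leqnSn n); have L1 := HX' x X'x n.+1 (leqnn _).
have l1 := iter_log_size_ge1 n x1; have le := HX x Xx.
have Y0 : 0 < iter_ln n x by lra.
rewrite iterS /log_size -/c.
have : ln (iter n (@log_size R) x) <= ln C + iter_ln n.+1 x.
  by rewrite iter_lnS -lnM ?posrE// ler_ln ?posrE ?mulr_gt0//; lra.
have := ler_norm (ln C); have := normr_ge0 (ln C).
move: (ln (iter n _ x)) (iter_ln n.+1 x) L1 (ln C) `|_| => a L L1 e b b0 eb aL.
apply: (@le_trans _ _ (1 + c * (b + L))); first by rewrite lerD2l ler_wpM2l ?(ltW c0)//; lra.
have : 0 <= c * b * (L - 1) by rewrite mulr_ge0 ?subr_ge0// mulr_ge0// ltW.
by nra.
Qed.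

Lemma near_pinftyP (P : R -> Prop) :
  (\forall x \near +oo, P x) <-> exists X, forall x, X <= x -> P x.
Proof.
split=> [[M [_ HM]]|[X HX]].
  by exists (M + 1) => x Mx; apply: HM; rewrite (lt_le_trans _ Mx)// ltrDl.
by exists X; split; [exact: num_real|move=> x /ltW /HX].
Qed.

Lemma half_truncn_le y : 1 <= y -> y <= 2 * (Num.truncn y)%:R.
Proof.
move=> y1; have y0 : 0 <= y by lra.
have /andP[_ lt] := truncn_itv y0.
have : 1 <= (Num.truncn y)%:R :> R by rewrite ler1n truncn_gt0.
by move: lt; rewrite -natr1; lra.
Qed.

End Logarithms.

(** * Explicit asymptotics in polynomial growth *)

Section PolynomialGrowth.
Local Open Scope fset_scope.
Local Open Scope ring_scope.
Variable R : realType.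
Implicit Types (p : R) (H : groupType).

(** With [u = Y / ln Y] and [r] of order [(80 K u) ^ (1 / d)], the ball has at least [80 * u]
    points, so [q >= 8 * u]. Since [u] is at least the square root of [Y], [ln q >= ln Y / 2], and
    [q * ln q >= 4 * Y > 2 * Y]. *)
Lemma polynomial_growth_radius H (S : {fset H}) d : (0 < d)%N -> polynomial_growth S d ->
  exists C : R, 0 < C /\ forall Y, 24 <= ln Y -> exists r : nat, [/\ (0 < r)%N,
    r%:R <= C * (Y / ln Y) `^ d%:R^-1 &
    expR (2 * Y) < ((#|` word_ball S r| %/ 8) ^ (#|` word_ball S r| %/ 8))%:R].
Proof.
move=> d_gt0 [K K_gt0 HK]; have dn : d%:R != 0 :> R by rewrite pnatr_eq0 -lt0n.
pose a : R := 80 * K%:R; have a_gt0 : 0 < a by rewrite mulr_gt0 ?ltr0n.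
exists (a `^ d%:R^-1 + 1); split=> [|Y L24]; first by rewrite addr_gt0// powR_gt0.
have L0 : 0 < ln Y by lra.
have := expR_half_le_div_ln L24; set u := Y / ln Y => ue.
have u1 : 1 <= u.
  by apply: le_trans ue; apply: le_trans (double_le_expR_half L24); lra.
have u0 : 0 < u by exact: lt_le_trans u1.
pose z := (a * u) `^ d%:R^-1; have z0 : 0 <= z by exact: powR_ge0.
have zd : z ^+ d = a * u.
  by rewrite -powR_mulrn// -powRrM mulVf// powRr1// mulr_ge0// ltW.
have /andP[z_ge z_lt] := truncn_itv z0.
exists (Num.truncn z).+1; set r := (Num.truncn z).+1; split=> //.
  rewrite -natr1 mulrDl mul1r lerD//.
    by apply: le_trans z_ge _; rewrite /z powRM// ltW.
  rewrite [leLHS](_ : 1 = 1 `^ d%:R^-1); last by rewrite powR1.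
  by rewrite ge0_ler_powR ?nnegrE ?invr_ge0// ltW.
set V := #|` word_ball S r|; set q := (V %/ 8)%N.
have V_ge : 80 * u <= V%:R.
  have : r%:R ^+ d <= K%:R * V%:R :> R.
    by rewrite -natrX -natrM ler_nat; apply: (HK r _).1.
  have : z ^+ d <= r%:R ^+ d by rewrite lerXn2r ?nnegrE// ltW.
  rewrite zd /a; have K0 : 0 < K%:R :> R by rewrite ltr0n.
  move=> le1 le2; rewrite -(ler_pM2l K0); apply: le_trans le2.
  by apply: le_trans le1; rewrite mulrA (mulrC 80).
have q_ge : 8 * u <= q%:R.
  have : (V < 8 * q.+1)%N by rewrite mulnC; exact: ltn_ceil.
  by rewrite -(ltr_nat R) natrM -natr1; lra.
have q0 : 0 < q%:R :> R by lra.
have qL : ln Y / 2 <= ln q%:R.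
  rewrite -[leLHS]expRK ler_ln ?posrE ?expR_gt0//; lra.
rewrite natrX -[ltRHS](lnK (x := _)) ?posrE ?exprn_gt0// lnXn// ltr_expR.
have YE : Y = u * ln Y by rewrite /u divfK// gt_eqF.
rewrite -[ltRHS]mulr_natl; apply: (@lt_le_trans _ _ (8 * u * (ln Y / 2))).
  by rewrite {1}YE; nra.
by apply: ler_pM => //; [rewrite mulr_ge0// ltW|lra].
Qed.

Lemma profile_le_polynomial_growth n H p (S : {fset H}) d
    (T : {fset shuffler_iter n (shuffler H)}) :
  1 <= p -> generates T -> (0 < d)%N -> polynomial_growth S d ->
  exists C : R, 0 < C /\ exists X, forall x, X <= x ->
    (profile p T x <= (C * (iter_ln n.+1 x / iter_ln n.+2 x) `^ d%:R^-1)%:E)%E.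
Proof.
move=> p1 gT d_gt0 gS; have [C1 [C1_gt0 H1]] := profile_le_ball S p1 gT.
have [C2 [C2_gt0 H2]] := polynomial_growth_radius d_gt0 gS.
have [C3 [C3_gt0 [X3 H3]]] := iter_log_size_le R n.
have [X HX] := iter_ln_large n.+2 (Num.max 24 C3).
exists (C1 * C2); split; first exact: mulr_gt0.
exists (Num.max X3 X) => x; rewrite ge_max => /andP[X3x Xx].
have lnj j : (j <= n.+2)%N -> 24 <= iter_ln j x /\ C3 <= iter_ln j x.
  by move=> /(HX x Xx); rewrite ge_max => /andP[].
have [r [r_gt0 rle rq]] := H2 (iter_ln n.+1 x) (lnj n.+2 (leqnn _)).1.
apply: le_trans (H1 x r r_gt0 _) _.
  apply: le_lt_trans (H3 x X3x) _; apply: le_lt_trans rq.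
  have -> : iter_ln n x = expR (iter_ln n.+1 x) by rewrite iter_ln_exp// (lnj n _).1// leqW.
  (* For [Y = iter_ln n.+1 x], one factor [expR Y] is the iterated logarithm and the other dominates
     [C3]; hence the radius adapted to [expR (2 * Y)]. *)
  rewrite mulr_natl mulr2n expRD ler_wpM2r ?expR_ge0//.
  rewrite iter_ln_exp; last by apply: (lnj _ _).1; rewrite leqW.
  by apply: (lnj _ _).2; rewrite leqW.
by rewrite lee_fin -mulrA ler_wpM2l ?(ltW C1_gt0).
Qed.

Lemma profile_ge_polynomial_growth n H p (S : {fset H}) d (T : {fset shuffler_iter n H}) :
  1 <= p -> generates S -> (0 < d)%N -> polynomial_growth S d ->
  exists C : R, 0 < C /\ exists X, forall x, X <= x ->
    (((iter_ln n x / iter_ln n.+1 x) `^ d%:R^-1)%:E <= C%:E * profile p T x)%E.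
Proof.
move=> p1 gS d_gt0 polS; have p_gt0 : 0 < p by exact: lt_le_trans p1.
have dn : d%:R != 0 :> R by rewrite pnatr_eq0 -lt0n.
have [T' [C1 [C1_gt0 H1]]] := profile_lift_iter T p_gt0.
have [C2 C2_gt0 H2] := profile_change T' p_gt0 gS.
have [K [C3 [K_gt0 C3_gt0 H3]]] := profile_ge_ball p_gt0 polS.
(* Chosen so that the integer part [k] of [v / a] satisfies [K * k ^ d <= u / 4], the size that
   [iter_sym_size_le] admits. *)
pose a : R := (4 * K%:R) `^ d%:R^-1.
have a_gt0 : 0 < a by rewrite powR_gt0// mulr_gt0 ?ltr0n.
have [X HX] := iter_ln_large n.+1 (Num.max 24 (4 * K%:R) : R).
exists (2 * a * (C3 * (C2 * C1))); split; first by rewrite !mulr_gt0.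
exists X => x Xx.
have lnj j : (j <= n.+1)%N -> 24 <= iter_ln j x /\ 4 * K%:R <= iter_ln j x.
  by move=> /(HX x Xx); rewrite ge_max => /andP[].
have [Y24 _] := lnj n (leqnSn _); have [L24 KL] := lnj n.+1 (leqnn _).
set Y := iter_ln n x in Y24 *; set L := iter_ln n.+1 x in L24 KL *.
have L0 : 0 < L by exact: lt_le_trans L24.
have uL : L <= Y / L.
  have := @expR_half_le_div_ln R Y L24; have := double_le_expR_half L24; rewrite -[ln Y]/L; lra.
set u := Y / L in uL *; have u0 : 0 < u by exact: lt_le_trans uL.
set v := u `^ d%:R^-1; have v0 : 0 <= v by exact: powR_ge0.
have va : 1 <= v / a.
  rewrite ler_pdivlMr// mul1r ge0_ler_powR ?nnegrE ?invr_ge0 ?(ltW u0) ?mulr_ge0//.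
  exact: le_trans KL uL.
set k := Num.truncn (v / a).
have k_gt0 : (0 < k)%N by rewrite truncn_gt0.
have vk : v <= 2 * a * k%:R.
  have := half_truncn_le va; rewrite ler_pdivrMr// => le.
  by apply: le_trans le _; rewrite mulrAC.
have kd : (K * k ^ d)%:R <= u / 4 :> R.
  have kva : k%:R <= v / a.
    by have /andP[] := truncn_itv (le_trans ler01 va).
  have : k%:R ^+ d <= (v / a) ^+ d by rewrite lerXn2r ?nnegrE// divr_ge0// ltW.
  rewrite expr_div_n -!powR_mulrn ?(ltW a_gt0)// -!powRrM mulVf// !powRr1 ?(ltW u0)//.
  rewrite powR_mulrn// natrM natrX => le.
  have K0 : 0 < K%:R :> R by rewrite ltr0n.
  apply: le_trans (ler_wpM2l (ltW K0) le) _.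
  rewrite le_eqVlt; apply/orP; left; apply/eqP; field.
  by rewrite gt_eqF.
have m_gt0 : (0 < K * k ^ d)%N by rewrite muln_gt0 K_gt0 expn_gt0 k_gt0.
have mx : (iter n sym_size (K * k ^ d)%N)%:R <= x.
  apply: iter_sym_size_le => //; first by move=> j /lnj[].
  by rewrite -/L -/Y (mulrC 4) invfM mulrA.
apply: (@le_trans _ _ ((2 * a)%:E * k%:R%:E)%E); first by rewrite -EFinM lee_fin.
rewrite (EFinM (2 * a)) -muleA lee_pmul2l ?lte_fin ?mulr_gt0//.
apply: le_trans (H3 k k_gt0) _; rewrite (EFinM C3) -muleA lee_pmul2l ?lte_fin//.
apply: le_trans (H2 (K * k ^ d)%:R) _; rewrite (EFinM C2) -muleA lee_pmul2l ?lte_fin//.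
apply: le_trans (H1 (K * k ^ d)%N) _; rewrite lee_pmul2l ?lte_fin//.
exact: profile_mono.
Qed.

End PolynomialGrowth.

(** * Both bounds under Assumption (star) *)

Section Comparison.
Local Open Scope fset_scope.
Local Open Scope ring_scope.
Variable R : realType.
Implicit Types (p : R) (H : groupType).

Lemma abs_profile H p (S : {fset H}) (x : R) : 0 < p -> 1 <= x ->
  (`|profile p S x| = profile p S x)%E.
Proof. by move=> p0 x1; rewrite gee0_abs// profile_ge0. Qed.

(** Slicing lands at exponent 1 and argument [C3 * iter_ln n x]; the comparison hypothesis returns
    to exponent [p] at the price of [C1], and Assumption (star) removes [C1 * C3]. *)
Lemma profile_slices_asymp_le n H p (S : {fset H}) (T : {fset shuffler_iter n H}) :
  1 <= p -> generates T -> asymp_le (profile 1 S) (profile p S) ->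
  assumption_star (profile p S) ->
  asymp_le (profile p T) (fun x : R => profile p S (iter_ln n x)).
Proof.
move=> p1 gT [C1 C1_gt0 [K1 K1_gt0 /near_pinftyP[X1 H1]]] star.
have p_gt0 : 0 < p by exact: lt_le_trans p1.
have [C2 [C2_gt0 H2]] := profile_le_slices S p1 gT.
have [C3 [C3_gt0 [X3 H3]]] := iter_log_size_le R n.
have [K4 K4_gt0 /near_pinftyP[X4 H4]] := star (C1 * C3) (mulr_gt0 C1_gt0 C3_gt0).
have [X HX] := iter_ln_large n (Num.max (Num.max 1 X4)
  (Num.max (C3^-1 * 1) (C3^-1 * X1))).
exists 1 => //; exists (C2 * K1 * K4); first by rewrite !mulr_gt0.
apply/near_pinftyP; exists (Num.max 1 (Num.max X3 X)) => x.
rewrite !ge_max mul1r => /and3P[x1 X3x Xx].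
have := HX x Xx n (leqnn n); rewrite !ge_max => /andP[/andP[Y1 Y4] /andP[Yc Yx]].
rewrite !ler_pdivrMl// in Yc Yx.
rewrite (abs_profile T p_gt0 x1) (abs_profile S p_gt0 Y1); apply: le_trans (H2 x) _.
rewrite -mulrA EFinM -muleA lee_pmul2l ?lte_fin//.
apply: le_trans (profile_mono 1 S (H3 x X3x)) _.
rewrite -(abs_profile S ltr01 Yc); apply: le_trans (H1 _ Yx) _.
rewrite EFinM -muleA lee_pmul2l ?lte_fin//.
by have := H4 _ Y4; rewrite (abs_profile S p_gt0 Y1) mulrA.
Qed.

(** Only sets of size about [Y / (4 * L)] have an iterated lift of guaranteed size at most [x]. The
    hypothesis on [x / ln x] moves the profile from [Y] down to that scale, and Assumption (star)
    absorbs the constants. *)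
Lemma profile_lift_asymp_le n H p (S : {fset H}) (T : {fset shuffler_iter n H}) :
  1 <= p -> generates S ->
  asymp_le (profile p S) (fun x : R => profile p S (x / ln x)) ->
  assumption_star (profile p S) ->
  asymp_le (fun x : R => profile p S (iter_ln n x)) (profile p T).
Proof.
move=> p1 gS [C1 C1_gt0 [K1 K1_gt0 /near_pinftyP[X1 H1]]] star.
have p_gt0 : 0 < p by exact: lt_le_trans p1.
have [T' [C2 [C2_gt0 H2]]] := profile_lift_iter T p_gt0.
have [C3 C3_gt0 H3] := profile_change T' p_gt0 gS.
have C16 : 0 < 16 * C1 by rewrite mulr_gt0.
have [K4 K4_gt0 /near_pinftyP[X4 H4]] := star (16 * C1) C16.
have [X HX] := iter_ln_large n.+1 (Num.max (Num.max 24 X1)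
  (Num.max (8 * X4) (- 2 * ln C1))).
exists 1 => //; exists (K1 * K4 * (C3 * C2)); first by rewrite !mulr_gt0.
apply/near_pinftyP; exists (Num.max 1 X) => x; rewrite ge_max mul1r => /andP[x1 Xx].
have lnj j : (j <= n.+1)%N -> 24 <= iter_ln j x.
  by move=> /(HX x Xx); rewrite !ge_max => /andP[/andP[]].
have := HX x Xx n (leqnSn n); rewrite !ge_max => /andP[/andP[Y24 YX1] _].
have := HX x Xx n.+1 (leqnn _); rewrite !ge_max => /andP[/andP[L24 _] /andP[LX4 LC1]].
set Y := iter_ln n x in Y24 YX1 *; set L := iter_ln n.+1 x in L24 LX4 LC1 *.
have L0 : 0 < L by exact: lt_le_trans L24.
have Y0 : 0 < Y by exact: lt_le_trans Y24.
have uL : 2 * L <= Y / L.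
  exact: le_trans (double_le_expR_half L24) (@expR_half_le_div_ln R Y L24).
have w6 : 1 <= Y / (4 * L) by rewrite (mulrC 4) invfM mulrA; lra.
pose m := Num.truncn (Y / (4 * L)).
have m_gt0 : (0 < m)%N by rewrite truncn_gt0.
have m1 : 1 <= m%:R :> R by rewrite ler1n.
have mle : m%:R <= Y / (4 * L) by have /andP[] := truncn_itv (le_trans ler01 w6).
have mge : Y / L <= 8 * m%:R.
  by have := half_truncn_le w6; rewrite -/m (mulrC 4) invfM mulrA; lra.
have mX4 : X4 <= m%:R by lra.
have mx : (iter n sym_size m)%:R <= x by exact: iter_sym_size_le.
have lnCY : L / 2 <= ln (C1 * Y) by rewrite lnM ?posrE// -[ln Y]/L; lra.
(* [16 = 2 * 8]: replacing [ln (C1 * Y)] by [L / 2] costs 2, and [Y / L <= 8 * m]. *)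
have le16 : C1 * Y / ln (C1 * Y) <= 16 * C1 * m%:R.
  apply: (@le_trans _ _ (C1 * Y / (L / 2))).
    have L2 : 0 < L / 2 by rewrite divr_gt0.
    apply: ler_wpM2l; first by rewrite mulr_ge0// ltW.
    by rewrite lef_pV2 ?posrE//; exact: lt_le_trans lnCY.
  rewrite (_ : C1 * Y / (L / 2) = C1 * 2 * (Y / L)); last by field; rewrite gt_eqF.
  by rewrite (_ : 16 * C1 * m%:R = C1 * 2 * (8 * m%:R)); [rewrite ler_pM2l ?mulr_gt0|ring].
have y1 : 1 <= C1 * Y / ln (C1 * Y).
  have ln0 : 0 < ln (C1 * Y) by lra.
  by rewrite ler_pdivlMr// mul1r ltW// ln_sublinear// mulr_gt0.
have Y1 : 1 <= Y by lra.
rewrite (abs_profile S p_gt0 Y1) (abs_profile T p_gt0 x1).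
have := H1 Y YX1; rewrite (abs_profile S p_gt0 Y1) (abs_profile S p_gt0 y1) => le1.
apply: le_trans le1 _; rewrite -(mulrA K1) (EFinM K1) -muleA lee_pmul2l ?lte_fin//.
apply: le_trans (profile_mono p S le16) _.
have Cm1 : 1 <= 16 * C1 * m%:R by exact: le_trans y1 le16.
have := H4 _ mX4; rewrite (abs_profile S p_gt0 m1) (abs_profile S p_gt0 Cm1) => le4.
apply: le_trans le4 _; rewrite (EFinM K4) -muleA lee_pmul2l ?lte_fin//.
apply: le_trans (H3 m%:R) _; rewrite (EFinM C3) -muleA lee_pmul2l ?lte_fin//.
apply: le_trans (H2 m) _; rewrite lee_pmul2l ?lte_fin//.
exact: profile_mono.
Qed.

End Comparison.

Theorem theoremC (R : realType) (p : R) (hp : 1 <= p) (n : nat)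
    (H : groupType) (S : {fset H}) (hS : generates S) (hH : amenable H)
    (hprof : asymp_eq (profile p S) (profile 1 S))
    (T : {fset shuffler_iter n H}) (hT : generates T) :
  (forall d : nat, (1 <= d)%N -> (1 <= n)%N -> polynomial_growth S d ->
     asymp_eq (profile p T)
       (fun x : R => ((iter_ln n x / iter_ln n.+1 x) `^ d%:R^-1)%:E))
  /\
  (assumption_star (profile p S) ->
   asymp_eq (fun x : R => profile p S (x / ln x)) (profile p S) ->
     asymp_eq (profile p T) (fun x : R => profile p S (iter_ln n x))).
Proof.
have p_gt0 : 0 < p by exact: lt_le_trans hp.
split=> [d d1 n1 gS|star [_ loc]]; last first.
  split; first exact: profile_slices_asymp_le hp hT hprof.2 star.
  exact: profile_lift_asymp_le hp hS loc star.
split.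
  (* [1 <= n] exposes the innermost lampshuffler [shuffler H], where the ball argument applies; the
     outer levels are sliced. *)
  case: n n1 T hT => // n _; rewrite /shuffler_iter iterSr => T gT.
  have [C [C_gt0 [X HX]]] := profile_le_polynomial_growth hp gT d1 gS.
  exists 1 => //; exists C => //; apply/near_pinftyP; exists (Num.max 1 X) => x.
  rewrite ge_max mul1r => /andP[x1 Xx].
  by rewrite abs_profile// abse_EFin ger0_norm ?powR_ge0// -EFinM; exact: HX.
have [C [C_gt0 [X HX]]] := profile_ge_polynomial_growth T hp hS d1 gS.
exists 1 => //; exists C => //; apply/near_pinftyP; exists (Num.max 1 X) => x.
rewrite ge_max mul1r => /andP[x1 Xx].
by rewrite abs_profile// abse_EFin ger0_norm ?powR_ge0//; exact: HX.
Qed.
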